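(* Let $\mathcal M$ be a (non-drifting) countable-state Markov decision process, let $Z\subset X$ be finite, and let $\mathcal M_0$, with $e:Z_0\to Z$, be the embedded finite-state Markov decision process constructed from $\mathcal M$ and $Z$ as described in the context. Fix a stationary Markov policy $\sigma$ of $\mathcal M$ and a state $z\in Z$ that is recurrent under $\sigma$, and let $\sigma_0$ be the stationary Markov policy of $\mathcal M_0$ associated with $\sigma$. Let $\nu=\inf\{k>0:x_k=z\}$. If $$C_\nu(z,\sigma)=E_z^\sigma\sum_{k=0}^{\nu-1}c(x_k,a_k)$$ is well defined (that is, it is finite when $c$ is replaced by $|c|$), then $$\lim_{N\to\infty}\frac1N C_N(z,\sigma)=\lim_{N\to\infty}\frac1N C^0_N(e^{-1}(z),\sigma_0).$$
   Context: **Markov decision process (MDP).** An MDP is a quadruplet $\mathcal M=(X,\{A_i\},c(i,a),P(j|i,a))$, where the state space $X\subset\{0,1,2,\dots\}$ is finite or countably infinite; for each $i\in X$, $A_i$ (also written $A(i)$) is a compact action set, a subset of an action space $A$; $c(i,a)$ is the running cost incurred, and $P(j|i,a)$ is the probability of moving from $i$ to $j$, when action $a\in A_i$ is chosen in state $i$. Time is discrete; $x_k,a_k$ denote state and action at time $k\ge0$. An admissible policy chooses $a_k\in A_{x_k}$, possibly at random, depending only on $(x_0,a_0,\dots,a_{k-1},x_k)$. A stationary Markov policy is a (possibly randomized) policy whose choice depends only on $x_k$ (through a time-independent rule); under it $\{x_k\}$ is a Markov chain, and $P(j|i,\sigma(i))$ denotes its transition probability (averaged over the randomization of $\sigma$ at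 $i$). $P_i^\pi,E_i^\pi$ denote probability and expectation under $\pi$ with $x_0=i$. Put $C_N(i,\pi)=E_i^\pi\sum_{k=0}^{N-1}c(x_k,a_k)$ and $J_i(\pi)=\liminf_N\frac1N C_N(i,\pi)$; $g^\star(\mathcal M)$ is the optimal (minimal) long-run average cost over admissible policies (the average cost being regarded as independent of the initial state, and then written $J(\pi)$). ''Recurrent'' is understood to include finite expected return time. **Non-drifting.** A stationary Markov policy $\sigma$ is drifting if for every finite $F\subset X$ and $i\in F$, $P_i^\sigma(x_k\in F)\to0$ as $k\to\infty$. $\mathcal M$ is drifting if there is $\delta>0$ such that every stationary Markov $\sigma$ with $J(\sigma)<g^\star(\mathcal M)+\delta$ is drifting; otherwise non-drifting. All MDPs $\mathcal M$ considered are non-drifting. **Exit and return times.** For finite $Z\subset X$: $\eta=\inf\{k\ge0:x_k\notin Z\}$, $\tau=\inf\{k>\eta:x_k\in Z\}$. For a stopping time $\nu>0$, $C_\nu(i,\pi)=E_i^\pi\sum_{k=0}^{\nu-1}c(x_k,a_k)$. For $\mathcal M_0$ (state-action process $\{(\xi_k,\alpha_k)\}$, running cost $c_0$) and $Z_0\subset X_0$, the quantities $\eta_0,\tau_0,C^0_\nu,C^0_N$ are defined analogously. **Construction of the embedded MDP $\mathcal M_0$.** Let $Z=\{z_1,\dots,z_n\}$, $Z_0=\{s_1,\dots,s_n\}$, $e(s_i)=z_i$, and $X_0=\{s_1,\dots,s_n\}\cup\{\omega_1,\dots,\omega_n\}$ ($2n$ distinct states). At $s_i$: action set $A_0(s_i)=A(z_i)$,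 cost $c_0(s_i,a)=c(z_i,a)$, and transitions $P_0(s_j|s_i,a)=P(z_j|z_i,a)$, $P_0(\omega_i|s_i,a)=1-\sum_{j=1}^nP(z_j|z_i,a)$, $P_0(\omega_j|s_i,a)=0$ for $j\ne i$. At $\omega_i$: actions are vectors $\alpha=(\lambda q_1,\dots,\lambda q_n,c)$ with $0<\lambda\le1$ and $(q_j)$ a probability vector. Such an action has transitions $P_0(s_j|\omega_i,\alpha)=\lambda q_j$, $P_0(\omega_i|\omega_i,\alpha)=1-\lambda$, $P_0(\omega_j|\omega_i,\alpha)=0$ for $j\neq i$, and cost $c_0(\omega_i,\alpha)=c$. Each stationary Markov policy $\sigma$ of $\mathcal M$ under which $Z$ contains a recurrent state induces at $\omega_i$ the action $\alpha(\sigma)=(\lambda q_1(\sigma),\dots,\lambda q_n(\sigma),c(\sigma))$ (depending also on $i$), defined as follows. - $q_j(\sigma)=P^\sigma\{x_\tau=z_j\mid x_{\eta-1}=z_i\}$. - $\lambda\in(0,1]$ is chosen so that $1+E^{\sigma_0}_{\omega_i}\tau_0=E^\sigma_{z_i}[\tau\mid\eta=1]$, where $E^{\sigma_0}_{\omega_i}\tau_0=1/\lambda$ is the mean time to enter $Z_0$ from $\omega_i$ using $\alpha(\sigma)$. - $c(\sigma)=\Big[\sum_{x_j\notin Z}P(x_j|z_i,\sigma(z_i))\Big]^{-1}\Big[\sum_{x_j\notin Z}P(x_j|z_i,\sigma(z_i))\,C_\tau(x_j,\sigma)\Big]\big[E_{\omega_i}^{\sigma_0}\tau_0\big]^{-1}$.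 The action set is $A_0(\omega_i)=\bigcup_\sigma\{\alpha(\sigma)\}$, the union being over all stationary Markov policies $\sigma$ of $\mathcal M$ under which $Z$ contains a recurrent state (and for which these quantities are well defined and finite). If $z_i$ is not accessible, under $\sigma$, from a state of $Z$ recurrent under $\sigma$, then $\sigma$ need not specify an action at $\omega_i$; if $Z$ cannot be left from $z_i$ in one step under $\sigma$, the action of $A_0(\omega_i)$ corresponding to $\sigma$ is arbitrary. **Associated policy.** The stationary Markov policy $\sigma_0$ of $\mathcal M_0$ associated with $\sigma$ uses at $s_i$ the rule $\sigma(z_i)$ and at $\omega_i$ the action $\alpha(\sigma)$. *)

(* Defs.v *)
From HB Require Import structures.
From mathcomp Require Import all_boot all_order all_algebra.
From mathcomp Require Import all_classical all_reals all_analysis.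
From mathcomp Require Import measurable_realfun.

Set Implicit Arguments.
Unset Strict Implicit.
Unset Printing Implicit Defensive.

Import Order.TTheory GRing.Theory Num.Theory.
Import numFieldNormedType.Exports.

Local Open Scope classical_set_scope.
Local Open Scope ring_scope.

(* Nonempty countable state spaces, i.e. nonempty subsets of {0, 1, 2, ...} up
   to renaming of the states; MathComp-Analysis builds sigma-algebras on
   pointed types only. *)
#[short(type="pcountType")]
HB.structure Definition PointedCountable := {T of Countable T & Pointed T}.

HB.instance Definition _ (T T' : pointedType) :=
  isPointed.Build (T + T')%type (inl point).

Definition measure_sum_display :
  measure_display * measure_display -> measure_display.
Proof. exact. Qed.

Section measurable_sum.
Context d d' (T : measurableType d) (T' : measurableType d').

Definition sum_measurable : set (set (T + T')) :=
  [set U | measurable (inl @^-1` U) /\ measurable (inr @^-1` U)].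

Let sum_measurable0 : sum_measurable set0.
Proof. by split; rewrite preimage_set0. Qed.

Let sum_measurableC U : sum_measurable U -> sum_measurable (~` U).
Proof. by move=> [? ?]; split; rewrite preimage_setC; exact: measurableC. Qed.

Let sum_measurable_bigcup (F : (set (T + T'))^nat) :
  (forall k, sum_measurable (F k)) -> sum_measurable (\bigcup_k F k).
Proof.
move=> mF; split; rewrite preimage_bigcup; apply: bigcupT_measurable => k.
- exact: (mF k).1.
- exact: (mF k).2.
Qed.

HB.instance Definition _ := @isMeasurable.Build (measure_sum_display (d, d'))
  (T + T')%type sum_measurable sum_measurable0 sum_measurableC
  sum_measurable_bigcup.

End measurable_sum.

Notation borel A := (g_sigma_algebraType (@open A)).

(* [trans i a j] is P(j|i,a).  The values of [cost i] and [trans i] off [act i]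
   are irrelevant: policies only use actions of [act i]. *)
Record mdp (R : realType) (X : pcountType) d (A : measurableType d) := MDP {
  act : X -> set A ;
  cost : X -> A -> R ;
  trans : X -> A -> X -> R ;
  act_neq0 : forall i, act i !=set0 ;
  measurable_cost : forall i, measurable_fun setT (cost i) ;
  measurable_trans : forall i j, measurable_fun setT (fun a => trans i a j) ;
  trans_ge0 : forall i a j, act i a -> 0 <= trans i a j ;
  trans_sum1 : forall i a, act i a ->
    (\esum_(j in [set: X]) (trans i a j)%:E = 1)%E }.

Section trajectories.
Context (X : pcountType) d (A : measurableType d).

(* Generators of the sigma-algebra of (x_0, ..., x_(p-1), a_0, ..., a_(q-1)). *)
Definition history_gen (p q : nat) : set (set (nat -> X * A)) :=
  [set G | (exists m i, (m < p)%N /\ G = [set w | (w m).1 = i]) \/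
           (exists m B, [/\ (m < q)%N, measurable B &
                            G = [set w | B (w m).2]])].

Definition history (p q : nat) := g_sigma_algebraType (history_gen p q).

Definition traj := g_sigma_algebraType (\bigcup_p history_gen p p).

End trajectories.
Arguments traj X {d} A.

Section policies.
Context (R : realType) (X : pcountType) d (A : measurableType d).
Variable M : mdp R X A.
Local Notation traj := (traj X A).

Definition rule := nat -> traj -> probability A R.

(* Measurability with respect to (x_0, a_0, ..., a_(k-1), x_k) expresses that
   the choice of a_k depends on nothing else. *)
Definition admissible (pi : rule) : Prop :=
  (forall k B, measurable B ->
     measurable_fun setT (fun w : history X A k.+1 k => pi k w B : \bar R)) /\
  (forall k w, {ae pi k w, forall a, act M (w k).1 a}).

Definition stationary (sigma : X -> probability A R) : Prop :=
  forall i, {ae sigma i, forall a, act M i a}.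

Definition markov_rule (sigma : X -> probability A R) : rule :=
  fun k w => sigma (w k).1.

Lemma stationary_admissible sigma : stationary sigma -> admissible (markov_rule sigma).
Proof.
move=> sM; split=> [k B mB _ Y mY|k w]; last exact: sM.
rewrite setTI.
have -> : (fun w : history X A k.+1 k => markov_rule sigma k w B) @^-1` Y =
  \bigcup_(n in [set n | exists2 i : X, unpickle n = Some i & Y (sigma i B)])
    [set w | unpickle n = Some (w k).1].
  apply/seteqP; split=> [w Yw|w [n [i ni Yi] /= nw]].
    by exists (pickle (w k).1); [exists (w k).1|]; rewrite /= ?pickleK.
  by move: nw; rewrite ni => -[iw]; rewrite /preimage/= /markov_rule -iw.
apply: bigcup_measurable => n _.
case: (unpickle n) => [i|].
  apply: sub_sigma_algebra; left; exists k, i; split; first exact: ltnSn.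
  by apply/seteqP; split=> w /= [->].
by rewrite (_ : [set w | _] = set0)//; apply/seteqP; split.
Qed.

(* [Q] is P_i^pi: the law of (x_0, a_0, x_1, a_1, ...) when x_0 = i, the law of
   a_k given x_0, a_0, ..., x_k is that prescribed by [pi], and the law of
   x_(k+1) given x_0, a_0, ..., x_k, a_k is P(.|x_k,a_k).  For an admissible
   [pi] there is exactly one such [Q] (Ionescu-Tulcea). *)
Record path_law (pi : rule) (i : X) (Q : probability traj R) : Prop := PathLaw {
  path_law_init : Q [set w | (w 0%N).1 = i] = 1%E ;
  path_law_act : forall k G B, measurable (G : set (history X A k.+1 k)) ->
    measurable B ->
    Q (G `&` [set w | B (w k).2]) = (\int[Q]_(w in G) pi k w B)%E ;
  path_law_trans : forall k G j,
    measurable (G : set (history X A k.+1 k.+1)) ->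
    Q (G `&` [set w | (w k.+1).1 = j]) =
    (\int[Q]_(w in G) (trans M (w k).1 (w k).2 j)%:E)%E }.

Definition path_laws (pi : rule) (Q : X -> probability traj R) : Prop :=
  forall i, path_law pi i (Q i).

Definition running_cost (N : nat) (w : traj) : \bar R :=
  (\sum_(k < N) cost M (w k).1 (w k).2)%:E.

Definition total_cost (Q : probability traj R) (N : nat) : \bar R :=
  (\int[Q]_w running_cost N w)%E.

Definition mean_cost (Q : probability traj R) (N : nat) : \bar R :=
  ((N%:R^-1)%:E * total_cost Q N)%E.

Definition expectation_defined (Q : probability traj R) (f : traj -> \bar R) :=
  ((\int[Q]_w (f^\+ w) < +oo)%E \/ (\int[Q]_w (f^\- w) < +oo)%E).

(* J(pi) = v: the long-run average cost of [pi] is [v] from every initial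
   state. *)
Definition average_cost (pi : rule) (v : \bar R) : Prop :=
  exists Q, [/\ path_laws pi Q,
    (forall i N, expectation_defined (Q i) (running_cost N)) &
    forall i, limn_einf (mean_cost (Q i)) = v].

Definition gstar : \bar R :=
  ereal_inf [set v | exists pi, admissible pi /\ average_cost pi v].

Definition drifting_policy (sigma : X -> probability A R) : Prop :=
  forall Q, path_laws (markov_rule sigma) Q ->
  forall (F : set X) i, finite_set F -> F i ->
    Q i [set w | F (w k).1] @[k --> \oo] --> 0%E.

Definition drifting : Prop :=
  exists delta : R, 0 < delta /\
    forall sigma v, stationary sigma -> average_cost (markov_rule sigma) v ->
      (v < gstar + delta%:E)%E -> drifting_policy sigma.

Definition nondrifting : Prop := ~ drifting.

End policies.

Section random_times.
Context (R : realType) (X : pcountType) d (A : measurableType d).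
Local Notation traj := (traj X A).
Local Open Scope ereal_scope.

Definition first_time (E : set nat) : \bar R := ereal_inf [set k%:R%:E | k in E].

Definition exit_time (Z : set X) (w : traj) : \bar R :=
  first_time [set k | ~ Z (w k).1].

Definition entry_time (Z : set X) (w : traj) : \bar R :=
  first_time [set k | exit_time Z w < k%:R%:E /\ Z (w k).1].

Definition return_time (y : X) (w : traj) : \bar R :=
  first_time [set k | (0 < k)%N /\ (w k).1 = y].

Definition recurrent (Q : X -> probability traj R) (y : X) : Prop :=
  Q y [set w | return_time y w < +oo] = 1 /\
  \int[Q y]_w return_time y w < +oo.

Definition accessible (Q : X -> probability traj R) (y x : X) : Prop :=
  exists k, 0 < Q y [set w | (w k).1 = x].

(* E sum_(k < nu) f(x_k, a_k); the inner series has finitely many terms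
   wherever [nu] is finite. *)
Definition cost_until (f : X -> A -> R) (Q : probability traj R)
    (nu : traj -> \bar R) : \bar R :=
  \int[Q]_w \sum_(0 <= k <oo | k%:R%:E < nu w) (f (w k).1 (w k).2)%:E.

Definition cond_prob (Q : probability traj R) (E F : set traj) : R :=
  fine (Q (E `&` F)) / fine (Q F).

Definition cond_mean (Q : probability traj R) (f : traj -> \bar R)
    (F : set traj) : \bar R :=
  \int[Q]_(w in F) f w * ((fine (Q F))^-1)%:E.

End random_times.
Arguments first_time {R} E.
Arguments exit_time {R X d A} Z w.
Arguments entry_time {R X d A} Z w.
Arguments return_time {R X d A} y w.

(* The sum of a signed family, when it is absolutely summable. *)
Definition signed_sum (R : realType) (T : choiceType) (D : set T)
    (f : T -> \bar R) : \bar R :=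
  (\esum_(x in D) f^\+ x - \esum_(x in D) f^\- x)%E.

Definition emb_state (n : nat) : Type := ('I_n.+1 + 'I_n.+1)%type.
HB.instance Definition _ n := Countable.on (emb_state n).
HB.instance Definition _ n := isPointed.Build (emb_state n) (inl ord0).

Definition s_ n (i : 'I_n.+1) : emb_state n := inl i.
Definition omega_ n (i : 'I_n.+1) : emb_state n := inr i.

Section embedded.
Context (R : realType) (X : pcountType) d (A : measurableType d).
Variable M : mdp R X A.
Context (n : nat) (z : 'I_n.+1 -> X).
Local Notation traj := (traj X A).
Local Notation Z := (range z).

(* The vectors (lambda q_1, ..., lambda q_n, c), as pairs. *)
Local Notation omega_act := (n.+1.-tuple R * R)%type.

Definition omega_vector (lam : R) (q : 'I_n.+1 -> R) (c : R)
    (alpha : omega_act) : Prop :=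
  [/\ 0 < lam <= 1, (forall j, 0 <= q j), \sum_j q j = 1 &
      alpha = ([tuple lam * q j | j < n.+1], c)].

Section induced.
Context (sigma : X -> probability A R) (Q : X -> probability traj R).
Variable i : 'I_n.+1.
Local Open Scope ereal_scope.

Definition mean_trans (x y : X) : \bar R := \int[sigma x]_a (trans M x a y)%:E.

Definition exit_prob : \bar R := \esum_(x in ~` Z) mean_trans (z i) x.

Definition leave_from : set traj :=
  [set w | exists k : nat, exit_time Z w = k.+1%:R%:E :> \bar R /\
                           (w k).1 = z i].

Definition enter_at (j : 'I_n.+1) : set traj :=
  [set w | exists k : nat, entry_time Z w = k%:R%:E :> \bar R /\
                           (w k).1 = z j].

Definition entry_prob (j : 'I_n.+1) : R :=
  cond_prob (Q (z i)) (enter_at j) leave_from.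

Definition mean_entry_time : \bar R :=
  cond_mean (Q (z i)) (entry_time Z) [set w | exit_time Z w = 1 :> \bar R].

Definition outer_cost (f : X -> A -> R) (x : X) : \bar R :=
  mean_trans (z i) x * cost_until f (Q x) (entry_time Z).

(* [alpha] is alpha(sigma) at omega_i, for a policy that can leave [Z] from
   [z i] and for which alpha(sigma) is well defined.  Since the holding time of
   omega_i under [alpha] is geometric, [lam^-1] is the mean time to enter Z_0
   from omega_i. *)
Definition induced_action (alpha : omega_act) : Prop :=
  exists lam q c, [/\ omega_vector lam q c alpha, 0 < exit_prob &
   [/\ (forall j, q j = entry_prob j),
       1 + (lam^-1)%:E = mean_entry_time,
       \esum_(x in ~` Z) outer_cost (fun y a => `|cost M y a|%R) x < +oo &
       c%:E = ((fine exit_prob)^-1)%:E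
              * signed_sum (~` Z) (outer_cost (cost M))
              * ((lam^-1)^-1)%:E]].

End induced.

Definition induced_actions (i : 'I_n.+1) : set omega_act :=
  [set alpha | exists sigma Q,
    [/\ stationary M sigma, path_laws M (markov_rule sigma) Q,
        (exists m, recurrent Q (z m)) & induced_action sigma Q i alpha]].

(* When no policy induces an action at omega_i, the action there is arbitrary. *)
Definition omega_actions (i : 'I_n.+1) : set omega_act :=
  [set alpha | induced_actions i alpha \/
    (induced_actions i = set0 /\ exists lam q c, omega_vector lam q c alpha)].


Lemma omega_actions_vector i alpha : omega_actions i alpha ->
  exists lam q c, omega_vector lam q c alpha.
Proof. by case=> [[sigma [Q [_ _ _ [lam [q [c [? _ _]]]]]]]|[_]//]; exists lam, q, c. Qed.

Lemma omega_actions_neq0 i : omega_actions i !=set0.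
Proof.
have [E|/set0P[alpha ?]] := eqVneq (induced_actions i) set0; last by exists alpha; left.
exists ([tuple 1 * (j == ord0)%:R | j < n.+1], 0); right; split=> //.
exists 1, (fun j => (j == ord0)%:R), 0; split=> //; first by rewrite ltr01 lexx.
by rewrite (bigD1 ord0)//= big1 ?addr0// => j /negbTE ->.
Qed.

Local Notation emb_action := (A + omega_act)%type.

Definition emb_act (x : emb_state n) : set emb_action :=
  match x with
  | inl i => inl @` act M (z i)
  | inr i => inr @` omega_actions i
  end.

Definition emb_cost (x : emb_state n) (a : emb_action) : R :=
  match x, a with
  | inl i, inl b => cost M (z i) b
  | inr i, inr alpha => alpha.2
  | _, _ => 0
  end.

Definition emb_trans (x : emb_state n) (a : emb_action) (y : emb_state n) : R :=
  match x, a, y with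
  | inl i, inl b, inl j => trans M (z i) b (z j)
  | inl i, inl b, inr j =>
      if j == i then 1 - \sum_k trans M (z i) b (z k) else 0
  | inr i, inr alpha, inl j => tnth alpha.1 j
  | inr i, inr alpha, inr j =>
      if j == i then 1 - \sum_k tnth alpha.1 k else 0
  | _, _, _ => 0
  end.

Lemma emb_act_neq0 x : emb_act x !=set0.
Proof.
case: x => i /=.
  by have [a ?] := act_neq0 M (z i); exists (inl a), a.
by have [a ?] := omega_actions_neq0 i; exists (inr a), a.
Qed.

Lemma measurable_fun_sum d' (U : measurableType d') (f : emb_action -> U) :
  measurable_fun setT (f \o inl) -> measurable_fun setT (f \o inr) ->
  measurable_fun setT f.
Proof.
move=> fl fr _ Y mY; rewrite setTI; split.
- by have := fl measurableT Y mY; rewrite setTI.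
- by have := fr measurableT Y mY; rewrite setTI.
Qed.

Lemma measurable_emb_cost x : measurable_fun setT (emb_cost x).
Proof.
apply: measurable_fun_sum; case: x => i /=; rewrite /comp/=.
- exact: measurable_cost.
- exact: measurable_cst.
- exact: measurable_cst.
- exact: measurable_snd.
Qed.

Lemma measurable_emb_trans x y :
  measurable_fun setT (fun a => emb_trans x a y).
Proof.
have mt j : measurable_fun setT (fun al : omega_act => tnth al.1 j).
  exact: (measurableT_comp (measurable_tnth j) measurable_fst).
apply: measurable_fun_sum; case: x y => i [j|j] /=; rewrite /comp/=;
  try exact: measurable_cst.
- exact: measurable_trans.
- case: (j == i); last exact: measurable_cst.
  apply: measurable_funB; first exact: measurable_cst.
  by apply: (@measurable_sum _ _ _ _ _ _ (fun k a => trans M (z i) a (z k))) => k;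
    exact: measurable_trans.
- exact: mt.
- case: (j == i); last exact: measurable_cst.
  apply: measurable_funB; first exact: measurable_cst.
  by apply: (@measurable_sum _ _ _ _ _ _ (fun k (al : omega_act) => tnth al.1 k)) => k; exact: mt.
Qed.

Hypothesis z_inj : injective z.

Lemma emb_sum_le1 i b : act M (z i) b -> \sum_k trans M (z i) b (z k) <= 1.
Proof.
move=> ib; rewrite -lee_fin -(trans_sum1 ib) -sumEFin.
apply: esum_ge; exists [set` [seq z k | k <- index_enum 'I_n.+1]].
  by split=> //; exact: finite_seq.
by rewrite -fsbig_seq ?map_inj_uniq ?index_enum_uniq// big_map.
Qed.

Lemma emb_trans_ge0 x a y : emb_act x a -> 0 <= emb_trans x a y.
Proof.
case: x => i /= [b ib <-]; case: y => j /=.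
- exact: trans_ge0.
- by case: ifP => // _; rewrite subr_ge0 emb_sum_le1.
- have [lam [q [c [/andP[l0 l1] q0 q1 ->]]]] := omega_actions_vector ib.
  by rewrite tnth_mktuple mulr_ge0// ltW.
- have [lam [q [c [/andP[l0 l1] q0 q1 ->]]]] := omega_actions_vector ib.
  case: ifP => // _; under eq_bigr do rewrite tnth_mktuple.
  by rewrite -mulr_sumr q1 mulr1 subr_ge0.
Qed.

Lemma emb_trans_sum1 x a : emb_act x a ->
  (\esum_(y in [set: emb_state n]) (emb_trans x a y)%:E = 1)%E.
Proof.
move=> xa; have -> : [set: emb_state n] =
    [set` index_enum ('I_n.+1 + 'I_n.+1)%type].
  by apply/seteqP; split=> // y _; exact: mem_index_enum.
rewrite esum_fset; first last.
- by move=> y _; rewrite lee_fin; exact: emb_trans_ge0.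
- exact: finite_seq.
rewrite -fsbig_seq ?index_enum_uniq// sumEFin big_sumType/=; congr (_%:E).
by case: x a xa => i [a|a] /= [b _ //= _];
  rewrite -big_mkcond big_pred1_eq addrC subrK.
Qed.

Definition embedded_mdp : mdp R (emb_state n) (A + omega_act)%type :=
  MDP emb_act_neq0 measurable_emb_cost measurable_emb_trans
      emb_trans_ge0 emb_trans_sum1.

(* At omega_i the policy is left free (within A_0(omega_i)) when z_i is not
   accessible from a state of Z recurrent under sigma, or when sigma induces no
   action at omega_i. *)
Definition associated (sigma : X -> probability A R)
    (Q : X -> probability traj R)
    (sigma0 : emb_state n -> probability (A + omega_act)%type R) : Prop :=
  [/\ stationary embedded_mdp sigma0,
      (forall i B, measurable B -> sigma0 (s_ i) B = sigma (z i) (inl @^-1` B)) &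
      (forall i alpha,
         (exists m, recurrent Q (z m) /\ accessible Q (z m) (z i)) ->
         induced_action sigma Q i alpha ->
         forall B, measurable B -> sigma0 (omega_ i) B = \d_(inr alpha) B)].

End embedded.

(* Main.v *)
Require Import Defs.
From mathcomp Require Import all_boot all_order all_algebra.
From mathcomp Require Import all_classical all_reals all_analysis.
From mathcomp Require Import measurable_realfun.
From mathcomp Require Import ring lra.

Set Implicit Arguments.
Unset Strict Implicit.
Unset Printing Implicit Defensive.

Import Order.TTheory GRing.Theory Num.Theory.
Import numFieldNormedType.Exports.

Local Open Scope classical_set_scope.
Local Open Scope ring_scope.

(* Under sigma the state process is a Markov chain with kernel p = mean_trans,
   and every quantity of the construction is a sum of powers of the taboo kernel
   (taboo D f)(x) = sum_(y notin D) p(x,y) f(y).  Let G_D f(x) be the expected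
   sum of f before the first positive time in D and H f = G_{z_i} f.  Both limits
   equal l = (H c+ - H c-)(z_i) / H 1(z_i).

   In M this is renewal theory: with u(m) = P(x_m = z_i), the expected cost at
   time k is the convolution sum_(m <= k) u(m) g(k - m), where g(r) is the cost
   at time r of a cycle; cost 1 gives sum_(m <= k) u(m) t(k - m) = 1, and the two
   convolutions bound the averages of u and then those of the cost.

   In M_0 the relative cost h(s_j) = H(c - l)(z_j) extends to the omega_j as a
   solution of the Poisson equation on the finite set of reachable states, so
   that the expected cost over N steps is N l up to a bounded error.  The
   equation at s_j is the strong Markov property of M at the first return to Z,
   G_{z_i} f = G_Z (f + sum_(z_l <> z_i) p(.,z_l) G_{z_i} f(z_l)), once the data
   of alpha(sigma) at omega_j are identified with taboo Z (G_Z f)(z_j) for f = 1,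
   c and p(.,z_l).  Positive recurrence makes alpha(sigma) well defined at every
   reachable omega_j. *)

(** * Taboo and Green operators of a transition kernel *)

(** The two chains call for different arguments. On an infinite [X] the relative cost may be
    unbounded, so a Poisson equation gives no uniform error there, whereas renewal averages need
    only finite cycle sums. In M_0 a renewal argument would require positive recurrence of [s_i] and
    its cycle moments; on a finite state space every solution of the Poisson equation is bounded,
    and neither has to be computed. The action alpha(sigma) replaces an excursion outside Z, of
    arbitrary duration and cost, by a geometric sojourn at a constant cost per step. It keeps the
    mean duration, the mean cost and the entry distribution, which is all that the Poisson equation
    sees. Kernel sums live in [0, +oo], and signed costs are split into positive and negative parts.
    Real numbers are formed only at states visited from z_i, to which finiteness of the cycle sums
    propagates. Elsewhere Green functions may be infinite and sigma_0 is not prescribed at omega_j,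
    so the argument in M_0 is confined to a closed set of states. *)

Section esum_complements.
Context {R : realType} {T : choiceType}.
Implicit Types (D : set T) (a : T -> \bar R).
Local Open Scope ereal_scope.

Lemma esum_ge_term D a x : (forall y, D y -> 0 <= a y) -> D x ->
  a x <= \esum_(y in D) a y.
Proof.
move=> a0 Dx; apply: esum_ge; exists [set x]; last by rewrite fsbig_set1.
by split; [exact: finite_set1|move=> _ ->].
Qed.

Lemma esum_eq0 D a : (forall y, D y -> 0 <= a y) ->
  \esum_(y in D) a y = 0 -> forall x, D x -> a x = 0.
Proof.
move=> a0 s0 x Dx; apply/eqP; rewrite eq_le a0// andbT -s0.
exact: esum_ge_term.
Qed.

(** For a finite positive [c], one inequality applied to [c] and to its inverse gives equality. For
    [c = +oo] both sides are 0 or +oo, according to whether [a] vanishes on [D]. *)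
Lemma esumZl D a c : 0 <= c -> (forall y, 0 <= a y) ->
  \esum_(y in D) (c * a y) = c * \esum_(y in D) a y.
Proof.
have le (r : R) b : (0 <= r)%R -> (forall y, 0 <= b y) ->
    \esum_(y in D) (r%:E * b y) <= r%:E * \esum_(y in D) b y.
  move=> r0 b0; apply: ge_ereal_sup => _ [F [finF FD] <-].
  rewrite -ge0_mule_fsumr//.
  apply: lee_wpmul2l; first by rewrite lee_fin.
  by apply: ereal_sup_ubound; exists F.
move=> + a0; case: c => [r|_|//].
- rewrite lee_fin le_eqVlt => /predU1P[<-|r0].
    by rewrite mul0e esum1// => i _; rewrite mul0e.
  apply/eqP; rewrite eq_le le ?(ltW r0)//= -lee_pdivlMl//.
  have -> : \esum_(y in D) a y = \esum_(y in D) (r^-1%:E * (r%:E * a y)).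
    by apply: eq_esum => y _; rewrite muleA -EFinM mulVf ?gt_eqF// mul1e.
  apply: le; first by rewrite invr_ge0 ltW.
  by move=> y; rewrite mule_ge0// lee_fin ltW.
- have [s0|s0] := eqVneq (\esum_(y in D) a y) 0.
    by rewrite s0 mule0 esum1// => i /(esum_eq0 (fun y _ => a0 y) s0) ->; rewrite mule0.
  have [x Dx ax] : exists2 x, D x & 0 < a x.
    apply: contrapT => /forall2NP H; move/eqP : s0; apply; apply: esum1 => x Dx.
    have [//|] := H x; move/negP; rewrite -leNgt => ax.
    by apply/eqP; rewrite eq_le ax a0.
  rewrite gt0_mulye; last first.
    by rewrite lt_neqAle eq_sym s0 esum_ge0.
  have := @esum_ge_term D (fun y => +oo * a y) _ _ Dx.
  rewrite gt0_mulye// leye_eq => H; apply/eqP/H => y _.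
  by rewrite mule_ge0.
Qed.

Lemma esum_nneseries D (a : T -> nat -> \bar R) :
  (forall x k, 0 <= a x k) ->
  \esum_(x in D) \sum_(0 <= k <oo) a x k = \sum_(0 <= k <oo) \esum_(x in D) a x k.
Proof.
move=> a0; rewrite nneseries_esumT; last by move=> k; exact: esum_ge0.
under eq_esum do rewrite nneseries_esumT//.
rewrite !esum_esum// (reindex_esum (setT `*` D) _ (fun x => (x.2, x.1)))//.
split=> //=.
- by move=> [i j] [].
- by move=> [i1 i2] [j1 j2] /= _ _ [] -> ->.
- by move=> [i1 i2] [Pi1 Qi2] /=; exists (i2, i1).
Qed.

End esum_complements.

Section taboo.
Context {R : realType} {X : choiceType}.
Variable p : X -> X -> \bar R.
Implicit Types (D : set X) (f g : X -> \bar R).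
Local Open Scope ereal_scope.

(* For D = set0 this is the transition operator. *)
Definition taboo D f : X -> \bar R := fun x => \esum_(y in ~` D) (p x y * f y).

(* The expected sum of f along the path from x, until the first positive time
   in D. *)
Definition green D f : X -> \bar R :=
  fun x => \sum_(0 <= k <oo) iter k (taboo D) f x.

Hypothesis p0 : forall x y, 0 <= p x y.

Lemma taboo_ge0 D f : (forall x, 0 <= f x) -> forall x, 0 <= taboo D f x.
Proof. by move=> f0 x; apply: esum_ge0 => y _; rewrite mule_ge0. Qed.

Lemma iter_taboo_ge0 D f k : (forall x, 0 <= f x) ->
  forall x, 0 <= iter k (taboo D) f x.
Proof. by move=> f0; elim: k => //= k IH x; exact: taboo_ge0. Qed.

Lemma green_ge0 D f : (forall x, 0 <= f x) -> forall x, 0 <= green D f x.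
Proof. by move=> f0 x; apply: nneseries_ge0 => k _ _; exact: iter_taboo_ge0. Qed.

Lemma le_taboo D D' f g : D' `<=` D -> (forall x, 0 <= g x) ->
  (forall x, f x <= g x) -> forall x, taboo D f x <= taboo D' g x.
Proof.
move=> DD' g0 fg x; apply: (@le_trans _ _ (taboo D g x)).
  by apply: le_esum => y _; exact: lee_wpmul2l.
rewrite /taboo [leLHS]esum_mkcond [leRHS]esum_mkcond; apply: le_esum => y _.
case: ifPn => [|_]; last by case: ifP => // _; rewrite mule_ge0.
by rewrite !inE => Dy; rewrite ifT// inE => /DD'.
Qed.

Lemma le_iter_taboo D D' f g k : D' `<=` D -> (forall x, 0 <= g x) ->
  (forall x, f x <= g x) -> forall x, iter k (taboo D) f x <= iter k (taboo D') g x.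
Proof.
move=> DD' g0 fg; elim: k => //= k IH; apply: le_taboo => //.
exact: iter_taboo_ge0.
Qed.

Lemma le_green D D' f g : D' `<=` D -> (forall x, 0 <= f x) ->
  (forall x, f x <= g x) -> forall x, green D f x <= green D' g x.
Proof.
move=> DD' f0 fg x; apply: lee_nneseries => k _; first by move=> *; exact: iter_taboo_ge0.
by apply: le_iter_taboo => // y; rewrite (le_trans (f0 y)).
Qed.

Lemma tabooD D f g : (forall x, 0 <= f x) -> (forall x, 0 <= g x) ->
  taboo D (f \+ g) = taboo D f \+ taboo D g.
Proof.
move=> f0 g0; apply/funext => x; rewrite /taboo -esumD; last 2 first.
- by move=> y _; rewrite mule_ge0.
- by move=> y _; rewrite mule_ge0.
by apply: eq_esum => y _; rewrite ge0_muleDr.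
Qed.

Lemma iter_tabooD D f g k : (forall x, 0 <= f x) -> (forall x, 0 <= g x) ->
  iter k (taboo D) (f \+ g) = iter k (taboo D) f \+ iter k (taboo D) g.
Proof.
move=> f0 g0; elim: k => //= k ->; rewrite tabooD//; exact: iter_taboo_ge0.
Qed.

Lemma tabooZ D c f : 0 <= c -> (forall x, 0 <= f x) ->
  taboo D (fun x => c * f x) = (fun x => c * taboo D f x).
Proof.
move=> c0 f0; apply/funext => x; rewrite /taboo -esumZl//; last first.
  by move=> y; rewrite mule_ge0.
by apply: eq_esum => y _; rewrite muleCA.
Qed.

Lemma iter_tabooZ D c f k : 0 <= c -> (forall x, 0 <= f x) ->
  iter k (taboo D) (fun x => c * f x) = (fun x => c * iter k (taboo D) f x).
Proof.
by move=> c0 f0; elim: k => //= k ->; rewrite tabooZ//; exact: iter_taboo_ge0.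
Qed.

Lemma taboo0 D : taboo D (cst 0) = cst 0.
Proof. by apply/funext => x; apply: esum1 => y _; rewrite mule0. Qed.

Lemma greenD D f g : (forall x, 0 <= f x) -> (forall x, 0 <= g x) ->
  green D (f \+ g) = green D f \+ green D g.
Proof.
move=> f0 g0; apply/funext => x; rewrite /green -nneseriesD; last 2 first.
- by move=> *; exact: iter_taboo_ge0.
- by move=> *; exact: iter_taboo_ge0.
by apply: eq_eseriesr => k _; rewrite iter_tabooD.
Qed.

Lemma greenZ D c f : 0 <= c -> (forall x, 0 <= f x) ->
  green D (fun x => c * f x) = (fun x => c * green D f x).
Proof.
move=> c0 f0; apply/funext => x; rewrite /green nneseries_esumT; last first.
  by move=> k; apply: iter_taboo_ge0 => y; rewrite mule_ge0.
rewrite nneseries_esumT; last by move=> k; exact: iter_taboo_ge0.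
rewrite -esumZl//; last by move=> k; exact: iter_taboo_ge0.
by apply: eq_esum => k _; rewrite iter_tabooZ.
Qed.

Lemma green0 D : green D (cst 0) = cst 0.
Proof.
apply/funext => x; rewrite /green eseries0// => k _ _.
by rewrite (_ : iter _ _ _ = cst 0)//; elim: k => //= k ->; rewrite taboo0.
Qed.

Lemma green_sum D (I : choiceType) (r : seq I) (F : I -> X -> \bar R) :
  (forall i x, 0 <= F i x) ->
  green D (fun x => \sum_(i <- r) F i x) = (fun x => \sum_(i <- r) green D (F i) x).
Proof.
move=> F0; elim: r => [|i r IH].
  under [RHS]eq_fun do rewrite big_nil.
  rewrite -[RHS](green0 D); congr green.
  by apply/funext => x; rewrite big_nil.
under [RHS]eq_fun do rewrite big_cons.
rewrite -[RHS]/(green D (F i) \+ (fun x => \sum_(i <- r) green D (F i) x)) -IH.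
rewrite -greenD//; last by move=> x; exact: sume_ge0.
by congr green; apply/funext => x; rewrite big_cons.
Qed.

Lemma taboo_sum D (I : choiceType) (r : seq I) (F : I -> X -> \bar R) :
  (forall i x, 0 <= F i x) ->
  taboo D (fun x => \sum_(i <- r) F i x) = (fun x => \sum_(i <- r) taboo D (F i) x).
Proof.
move=> F0; apply/funext => x; rewrite /taboo.
rewrite -(@esum_sum _ _ _ _ _ _ (fun y i => p x y * F i y)); last first.
  by move=> *; rewrite mule_ge0.
by apply: eq_esum => y _; rewrite ge0_sume_distrr.
Qed.

(** Each application of the operator drops the first term of the Green series; the interchange of
    sums is free, all terms being nonnegative. *)
Lemma taboo_green D f k : (forall x, 0 <= f x) -> forall x,
  iter k (taboo D) (green D f) x = \sum_(k <= j <oo) iter j (taboo D) f x.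
Proof.
move=> f0; elim: k => //= k IH x; rewrite -nneseries_addn; last first.
  by move=> j; exact: iter_taboo_ge0.
rewrite /taboo.
transitivity (\esum_(y in ~` D)
    \sum_(0 <= i <oo) (p x y * iter (i + k) (taboo D) f y)).
  apply: eq_esum => y _; rewrite IH -nneseries_addn; last first.
    by move=> j; exact: iter_taboo_ge0.
  rewrite nneseries_esumT; last by move=> j; exact: iter_taboo_ge0.
  rewrite -esumZl//; last by move=> j; exact: iter_taboo_ge0.
  by rewrite nneseries_esumT// => j; rewrite mule_ge0//; exact: iter_taboo_ge0.
rewrite esum_nneseries; last by move=> y j; rewrite mule_ge0//; exact: iter_taboo_ge0.
by apply: eq_eseriesr => j _; rewrite addnS.
Qed.

Lemma green_rec D f : (forall x, 0 <= f x) ->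
  forall x, green D f x = f x + taboo D (green D f) x.
Proof.
move=> f0 x; rewrite -[taboo D _]/(iter 1 (taboo D) _) taboo_green//.
by rewrite {1}/green nneseries_recl// => k _; exact: iter_taboo_ge0.
Qed.

(** Unfolding the equation [N] times writes [h x] as a partial sum of the Green series plus a
    remainder. The equation alone may have larger nonnegative solutions; the vanishing remainder at
    [x] excludes them there. *)
Lemma green_unique D f h x : (forall x, 0 <= f x) -> (forall x, 0 <= h x) ->
  h = f \+ taboo D h -> iter N (taboo D) h x @[N --> \oo] --> 0 ->
  h x = green D f x.
Proof.
move=> f0 h0 hE hN.
have E N : h x = \sum_(0 <= k < N) iter k (taboo D) f x + iter N (taboo D) h x.
  elim: N => [|N IH]; first by rewrite big_geq// add0e.
  rewrite big_nat_recr//= -addeA IH; congr +%E.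
  rewrite -iterS iterSr {1}hE iter_tabooD//; exact: taboo_ge0.
have : \sum_(0 <= k < N) iter k (taboo D) f x + iter N (taboo D) h x
    @[N --> \oo] --> green D f x + 0.
  apply: cvgeD => //; first by rewrite ge0_adde_def ?inE//; exact: green_ge0.
  by apply: is_cvg_nneseries => *; exact: iter_taboo_ge0.
rewrite adde0; under eq_fun do rewrite -E.
by move/(cvg_lim (@ereal_hausdorff R)) <-; rewrite lim_cst.
Qed.

(** A larger taboo set gives smaller powers, and for [D] itself the powers applied to [green D f]
    are tails of a convergent series. *)
Lemma iter_taboo_green_cvg0 D D' f x : D `<=` D' -> (forall x, 0 <= f x) ->
  green D f x < +oo -> iter N (taboo D') (green D f) x @[N --> \oo] --> 0.
Proof.
move=> DD' f0 fin; have g0 := green_ge0 D f0.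
apply: (@squeeze_cvge _ _ _ _ (cst 0) _ (fun N => \sum_(N <= j <oo) iter j (taboo D) f x)).
- near=> N; rewrite iter_taboo_ge0//= -taboo_green//.
  exact: le_iter_taboo.
- exact: cvg_cst.
- by apply: nneseries_tail_cvg => // *; exact: iter_taboo_ge0.
Unshelve. all: by end_near. Qed.

(* Strong Markov property at the first positive time in D'. *)
Lemma green_split D D' f x : D `<=` D' -> (forall x, 0 <= f x) ->
  green D f x < +oo ->
  green D f x =
  green D' (f \+ (fun y => \esum_(w in D' `\` D) (p y w * green D f w))) x.
Proof.
move=> DD' f0 fin; have g0 := green_ge0 D f0.
set e := (X in f \+ X).
have e0 y : 0 <= e y by apply: esum_ge0 => w _; rewrite mule_ge0.
apply: green_unique => //.
- by move=> y; rewrite adde_ge0.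
- apply/funext => y /=; rewrite [LHS]green_rec// -addeA; congr +%E.
  rewrite /taboo (esumID D'); last first.
    by move=> w _; rewrite mule_ge0.
  rewrite /e setIC; congr (_ + _).
  by rewrite -setCU; congr esum; congr setC; exact/setUidPr.
- exact: iter_taboo_green_cvg0.
Qed.

(** The left-hand side is the probability of ever reaching [D]. The constant 1 solves the same
    equation because rows sum to 1, and a finite mean passage time makes its remainder vanish. *)
Lemma green_entry D x : (forall y, \esum_(w in setT) p y w = 1) ->
  green D (cst 1) x < +oo ->
  green D (fun y => \esum_(w in D) p y w) x = 1.
Proof.
move=> p1 fin; apply/esym; apply: (@green_unique _ _ (cst 1)) => //.
- by move=> y; exact: esum_ge0.
- apply/funext => y /=; rewrite -[LHS](p1 y) (esumID D)// !setTI; congr +%E.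
  by apply: eq_esum => w _; rewrite /cst mule1.
- have := @iter_taboo_green_cvg0 _ _ _ x (@subset_refl _ D) (fun=> lee01) fin.
  apply: (@squeeze_cvge _ _ _ _ (cst 0)); last exact: cvg_cst.
  near=> N; rewrite iter_taboo_ge0//=; apply: le_iter_taboo => // y.
    exact: green_ge0.
  by rewrite green_rec// leeDl// taboo_ge0//; exact: green_ge0.
Unshelve. all: by end_near. Qed.

(** By [green_rec], [p x y * green p D f y] is part of a finite sum, which a positive [p x y] turns
    into finiteness at [y]. *)
Lemma green_lty_step D f x y : (forall x, 0 <= f x) -> green D f x < +oo ->
  0 < p x y -> ~ D y -> green D f y < +oo.
Proof.
move=> f0; rewrite green_rec// => fin pxy Dy.
have t : taboo D (green D f) x < +oo.
  by apply: le_lt_trans fin; rewrite leeDr.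
have : p x y * green D f y < +oo.
  apply: le_lt_trans t; apply: (esum_ge_term (a := fun y => p x y * _)) => // w _.
  by rewrite mule_ge0//; exact: green_ge0.
by rewrite !ltey; apply: contraNneq => ->; rewrite gt0_muley.
Qed.

End taboo.

(** * Renewal averages *)

Section renewal.
Context {R : realType}.
Implicit Types (u t g x : nat -> R).

(** The bounds may change with [e]: a series truncated at level [K] yields bounds whose limits are
    only close to [L]. *)
Lemma cvg_sandwich x (L : R) :
  (forall e, 0 < e -> exists lo hi a b, [/\ lo @ \oo --> a, hi @ \oo --> b,
     L - e <= a, b <= L + e & forall N, lo N <= x N <= hi N]) ->
  x @ \oo --> L.
Proof.
move=> H; apply/cvgrPdist_le => e e0.
have e20 : 0 < e / 2 by rewrite divr_gt0.
have [lo [hi [a [b [/cvgrPdist_le la /cvgrPdist_le hb aL bL lh]]]]] := H _ e20.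
near=> N.
have A : `|a - lo N| <= e / 2 by near: N; exact: la.
have B : `|b - hi N| <= e / 2 by near: N; exact: hb.
have /andP[C D] := lh N.
move: A B; rewrite !ler_norml => /andP[? ?] /andP[? ?].
by apply/andP; split; lra.
Unshelve. all: by end_near. Qed.

Lemma sum_convolution u g N :
  \sum_(k < N) \sum_(m < k.+1) u m * g (k - m)%N =
  \sum_(m < N) u m * series g (N - m)%N.
Proof.
elim: N => [|N IH]; first by rewrite !big_ord0.
rewrite big_ord_recr/= IH [in LHS]big_ord_recr [RHS]big_ord_recr/= addrA -big_split/=.
rewrite subnn subSnn; congr (_ + _ * _); last by rewrite /series/= big_nat1.
apply: eq_bigr => m _; rewrite -mulrDr; congr (_ * _).
by rewrite subSn ?(ltnW (ltn_ord m))// /series/= big_nat_recr.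
Qed.

Section bounds.
Variables (u g : nat -> R) (S : R).
Hypotheses (u0 : forall k, 0 <= u k) (u1 : forall k, u k <= 1).
Hypotheses (g0 : forall k, 0 <= g k) (gS : series g @ \oo --> S).

Let nd : {homo series g : m n / (m <= n)%N >-> m <= n}.
Proof. by apply/nondecreasing_series => i _ _; exact: g0. Qed.

Let serS N : series g N <= S.
Proof.
rewrite -(cvg_lim _ gS)//; apply: nondecreasing_cvgn_le => //.
by apply/cvg_ex; exists S.
Qed.

Lemma convolution_le N :
  \sum_(k < N) \sum_(m < k.+1) u m * g (k - m)%N <= series u N * S.
Proof.
rewrite sum_convolution /series/= big_mkord mulr_suml; apply: ler_sum => m _.
by rewrite ler_wpM2l// -/(series g _) serS.
Qed.

(** For [m] at most [N - K] the inner factor is at least [series g K]. The remaining terms, at most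
    [K] of them, are given up at a cost of at most [series g K] each, since [u] is bounded by 1. *)
Lemma convolution_ge N K : (series u N - K%:R) * series g K <=
  \sum_(k < N) \sum_(m < k.+1) u m * g (k - m)%N.
Proof.
have sg0 j : 0 <= series g j by rewrite /series/= sumr_ge0.
rewrite sum_convolution mulrBl lerBlDr.
have uE : series u N = \sum_(m < N) u m by rewrite /series/= big_mkord.
have -> : K%:R * series g K = \sum_(m < K) series g K.
  by rewrite sumr_const card_ord mulr_natl.
rewrite uE mulr_suml {uE}.
have [NK|KN] := leqP N K.
  apply: (@le_trans _ _ (\sum_(m < K) series g K)); last first.
    by rewrite lerDr sumr_ge0// => m _; rewrite mulr_ge0.
  rewrite -[X in _ <= \sum_(m < X) _](subnKC NK) big_split_ord/= ler_wpDr ?sumr_ge0//.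
  by apply: ler_sum => m _; rewrite ler_piMl.
have [M NE] : exists M, N = (M + K)%N by exists (N - K)%N; rewrite subnK// ltnW.
rewrite {}NE {KN} !big_split_ord/= ; apply: lerD.
  rewrite ler_wpDr//; first by rewrite sumr_ge0// => m _; rewrite mulr_ge0.
  apply: ler_sum => m _; rewrite ler_wpM2l// nd//.
  by rewrite addnC -addnBA ?leq_addr// ltnW.
by apply: ler_sum => m _; rewrite ler_piMl.
Qed.

End bounds.

(** Truncation at [K] bounds [(series u N - K) * series t K] by [N], which is at most
    [series u N * T]; hence [series u N / N] tends to [1 / T]. The same two bounds for [g] then give
    [S / T]. Averages of [u] are used because its terms need not converge for a periodic chain. *)
Theorem renewal_cesaro u t g (T S : R) :
  (forall k, 0 <= u k) -> (forall k, 0 <= t k) -> (forall k, 0 <= g k) ->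
  t 0%N = 1 -> (forall k, \sum_(m < k.+1) u m * t (k - m)%N = 1) ->
  series t @ \oo --> T -> series g @ \oo --> S ->
  N%:R^-1 * \sum_(k < N) \sum_(m < k.+1) u m * g (k - m)%N @[N --> \oo] --> S / T.
Proof.
move=> u0 t0 g0 t01 ut tT gS.
have u1 k : u k <= 1.
  by rewrite -(ut k) big_ord_recr/= subnn t01 mulr1 lerDr sumr_ge0// => m _; rewrite mulr_ge0.
have sum1 N : \sum_(k < N) \sum_(m < k.+1) u m * t (k - m)%N = N%:R.
  by rewrite (eq_bigr (fun=> 1))// sumr_const card_ord.
have tge1 K : 1 <= series t K.+1.
  by rewrite /series/= big_nat_recl//= t01 lerDl sumr_ge0.
have T1 : 1 <= T.
  apply: cvgr_to_ge tT _; near=> K; rewrite -(@prednK K)//; near: K.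
  by exists 1%N.
have T0 : 0 < T by exact: lt_le_trans T1.
have oneN : N%:R^-1 * N%:R @[N --> \oo] --> (1 : R).
  apply: cvg_near_cst; exists 1%N => // N /= N0.
  by rewrite mulVf// pnatr_eq0 -lt0n.
have invN : (N%:R^-1 : R) @[N --> \oo] --> 0.
  by rewrite -cvg_shiftS; exact: cvg_harmonic.
have ucvg : N%:R^-1 * series u N @[N --> \oo] --> T^-1.
  apply: cvg_sandwich => e e0.
  have /cvgrPdist_le/(_ e e0)[K _ HK] : (series t K)^-1 @[K --> \oo] --> T^-1.
    by apply: cvgV => //; rewrite gt_eqF.
  have tK0 : 0 < series t K.+1 by exact: lt_le_trans (tge1 K).
  (* The product [N%:R^-1 * N%:R] is kept because it is 0 at [N = 0], where the bounds must hold
     too. The truncation is at [K.+1] because [series t 0] is an empty sum and cannot be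
     inverted. *)
  exists (fun N => N%:R^-1 * N%:R * T^-1),
    (fun N => N%:R^-1 * N%:R * (series t K.+1)^-1 + N%:R^-1 * K.+1%:R).
  exists (1 * T^-1), (1 * (series t K.+1)^-1 + 0 * K.+1%:R); split.
  - by apply: cvgM => //; exact: cvg_cst.
  - by apply: cvgD; apply: cvgM => //; exact: cvg_cst.
  - by rewrite mul1r gerBl ltW.
  - rewrite mul1r mul0r addr0; have := HK K.+1 (leqnSn K).
    by rewrite /= ler_norml => /andP[? _]; lra.
  - move=> N; rewrite -!mulrA -mulrDr.
    have N0 : 0 <= N%:R^-1 :> R by rewrite invr_ge0.
    rewrite !ler_wpM2l//=.
      rewrite -lerBlDr ler_pdivlMr// -[leRHS]sum1.
      exact: convolution_ge.
    rewrite ler_pdivrMr// -[leLHS]sum1.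
    exact: convolution_le.
apply: cvg_sandwich => e e0.
have /cvgrPdist_le/(_ e e0)[K _ HK] : series g K / T @[K --> \oo] --> S / T.
  by apply: cvgM => //; exact: cvg_cst.
exists (fun N => (N%:R^-1 * series u N - N%:R^-1 * K%:R) * series g K),
  (fun N => N%:R^-1 * series u N * S).
exists ((T^-1 - 0 * K%:R) * series g K), (T^-1 * S); split.
- apply: cvgM; last exact: cvg_cst.
  by apply: cvgB => //; apply: cvgM => //; exact: cvg_cst.
- by apply: cvgM => //; exact: cvg_cst.
- have := HK K (leqnn K); rewrite /= ler_norml => /andP[_].
  by rewrite mul0r subr0 mulrC; lra.
- by rewrite mulrC lerDl ltW.
- move=> N; rewrite -mulrBr -!mulrA !ler_wpM2l ?invr_ge0//=.
    exact: convolution_le.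
  exact: convolution_ge.
Unshelve. all: by end_near. Qed.

End renewal.

(** * Last visits to a state and averages along a transition kernel *)

Section kernel_renewal.
Context {R : realType} {X : choiceType}.
Variables (p : X -> X -> \bar R) (x0 : X).
Local Open Scope ereal_scope.
Hypothesis p0 : forall x y, 0 <= p x y.
Hypothesis p1 : forall x, \esum_(y in [set: X]) p x y = 1.
Implicit Type f : X -> \bar R.
Local Notation step := (taboo p set0).
Local Notation taboo0 := (taboo p [set x0]).

Let at0 y : \bar R := (y == x0)%:R%:E.

Let at0_ge0 y : 0 <= at0 y. Proof. by rewrite lee_fin. Qed.

Let visit k := iter k step at0 x0.

Let visit_ge0 k : 0 <= visit k. Proof. exact: iter_taboo_ge0. Qed.

Lemma step_taboo f : (forall x, 0 <= f x) ->
  step f = taboo0 f \+ (fun x => f x0 * p x x0).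
Proof.
move=> f0; apply/funext => x /=; rewrite {1}/taboo setC0 (esumID [set x0]).
  rewrite !setTI addeC; congr (_ + _).
  by rewrite esum_set1 1?muleC// mule_ge0.
by move=> y _; rewrite mule_ge0.
Qed.

Lemma step_at0 : step at0 = p ^~ x0.
Proof.
rewrite step_taboo//; apply/funext => x /=.
rewrite /taboo esum1 ?add0e; first by rewrite /at0 eqxx mul1e.
by move=> y /= /eqP/negPf yx; rewrite /at0 yx mule0.
Qed.

(** The index [m] is the time of the last visit to [x0] up to time [k]. The induction peels off the
    step next to [f]: by [step_taboo] it either avoids [x0], which is the induction hypothesis for
    [taboo0 f], or ends at [x0], which is the new term [m = k + 1]. *)
Lemma renewal_decomposition f k : (forall x, 0 <= f x) ->
  iter k step f x0 = \sum_(m < k.+1) visit m * iter (k - m) taboo0 f x0.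
Proof.
elim: k f => [|k IH] f f0.
  by rewrite big_ord1 subnn /= /visit/= /at0 eqxx mul1e.
rewrite iterSr step_taboo// iter_tabooD//; last 2 first.
- exact: taboo_ge0.
- by move=> x; rewrite mule_ge0.
rewrite /= (iter_tabooZ p0)// IH; last exact: taboo_ge0.
rewrite [RHS]big_ord_recr/= subnn; congr (_ + _).
  by apply: eq_bigr => m _; rewrite subSn -?iterSr// -ltnS.
by rewrite /= muleC -step_at0 -iterSr.
Qed.

Lemma iter_step1 k : iter k step (cst 1) = cst 1.
Proof.
elim: k => //= k ->; apply/funext => x; rewrite -[RHS](p1 x) /taboo setC0.
by apply: eq_esum => y _; rewrite mule1.
Qed.

Lemma series_green f : (forall x, 0 <= f x) -> green p [set x0] f x0 < +oo ->
  (forall k, iter k taboo0 f x0 \is a fin_num) /\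
  series (fun k => fine (iter k taboo0 f x0)) @ \oo --> fine (green p [set x0] f x0).
Proof.
move=> f0 fin; have it0 k : 0 <= iter k taboo0 f x0 by exact: iter_taboo_ge0.
have itf k : iter k taboo0 f x0 \is a fin_num.
  rewrite ge0_fin_numE//; apply: le_lt_trans fin.
  rewrite /green nneseries_esumT//.
  exact: (esum_ge_term (a := fun k => iter k taboo0 f x0)).
split => //; have gfin : green p [set x0] f x0 \is a fin_num.
  by rewrite ge0_fin_numE//; exact: green_ge0.
have : \sum_(0 <= k < N) iter k taboo0 f x0 @[N --> \oo] --> green p [set x0] f x0.
  by apply: is_cvg_nneseries => k _ _; exact: it0.
rewrite -{1}(fineK gfin) => /fine_cvg; apply: cvg_trans; apply: near_eq_cvg.
apply: nearW => N /=; by rewrite /series/= sum_fine.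
Qed.

Lemma cesaro_iter_step f : (forall x, 0 <= f x) ->
  green p [set x0] (cst 1) x0 < +oo -> green p [set x0] f x0 < +oo ->
  (forall k, iter k step f x0 < +oo) /\
  (N%:R^-1 * \sum_(k < N) fine (iter k step f x0))%R @[N --> \oo] -->
    (fine (green p [set x0] f x0) / fine (green p [set x0] (cst 1%E) x0))%R.
Proof.
move=> f0 fin1 finf.
have [tf tcvg] := series_green (fun=> lee01) fin1.
have [gf gcvg] := series_green f0 finf.
have it0 g k : (forall x, 0 <= g x) -> 0 <= iter k taboo0 g x0.
  by move=> g0; exact: iter_taboo_ge0.
(* Starting from [x0] there is always a last visit up to time [k]. The term [m = k] bounds [visit k]
   by 1, which gives its finiteness below. *)
have dec1 k : 1 = \sum_(m < k.+1) visit m * iter (k - m) taboo0 (cst 1) x0.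
  by rewrite -renewal_decomposition// iter_step1.
have vf k : visit k \is a fin_num.
  rewrite ge0_fin_numE//; apply: (@le_lt_trans _ _ 1); last exact: ltry.
  rewrite [leRHS](dec1 k) big_ord_recr/= subnn/= mule1 leeDr// sume_ge0// => m _.
  by rewrite mule_ge0// it0.
have decf g k : (forall x, 0 <= g x) -> (forall k, iter k taboo0 g x0 \is a fin_num) ->
    iter k step g x0 =
    (\sum_(m < k.+1) fine (visit m) * fine (iter (k - m) taboo0 g x0))%R%:E.
  move=> g0 gfin; rewrite renewal_decomposition// -sumEFin.
  by apply: eq_bigr => m _; rewrite EFinM !fineK.
split=> [k|]; first by rewrite decf// ltry.
rewrite (_ : (fun N => _) = (fun N => N%:R^-1 * \sum_(k < N) \sum_(m < k.+1)
    fine (visit m) * fine (iter (k - m) taboo0 f x0))%R); last first.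
  by apply/funext => N; congr (_ * _)%R; apply: eq_bigr => k _; rewrite decf.
refine (@renewal_cesaro R (fun m => fine (visit m))
  (fun k => fine (iter k taboo0 (cst 1) x0))
  (fun k => fine (iter k taboo0 f x0)) _ _ _ _ _ _ _ tcvg gcvg).
- by move=> k; rewrite fine_ge0.
- by move=> k; rewrite fine_ge0// it0.
- by move=> k; rewrite fine_ge0// it0.
- by [].
- by move=> k; apply: EFin_inj; rewrite -(decf (cst 1))// iter_step1.
Qed.

End kernel_renewal.

(** * The Poisson equation on a finite chain *)

Lemma esum_enum (R : realType) (X : choiceType) (s : seq X) (f : X -> \bar R) :
  uniq s -> (forall x, x \in s) -> (forall x, 0 <= f x)%E ->
  (\esum_(x in [set: X]) f x = \sum_(x <- s) f x)%E.
Proof.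
move=> us sX f0; have -> : [set: X] = [set` s] by apply/seteqP; split=> // x _; exact: sX.
by rewrite esum_fset// -fsbig_seq.
Qed.

Section finite_poisson.
Context {R : realType} {X : choiceType}.
Variables (q : X -> X -> \bar R) (s : seq X).
Hypotheses (us : uniq s) (sX : forall x, x \in s).
Hypothesis q0 : forall x y, (0 <= q x y)%E.
Hypothesis q1 : forall x, (\esum_(y in [set: X]) q x y = 1)%E.
Variable S : set X.
Hypothesis S_closed : forall x y, S x -> (0 < q x y)%E -> S y.
Local Notation step := (taboo q set0).
Local Notation qr x y := (fine (q x y)).

Let q_out x y : S x -> ~ S y -> q x y = 0%E.
Proof.
move=> Sx nSy; apply/eqP; rewrite eq_le q0 andbT leNgt; apply/negP => qxy.
exact: nSy (S_closed Sx qxy).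
Qed.

Let qf x y : q x y \is a fin_num.
Proof.
rewrite ge0_fin_numE//; apply: (@le_lt_trans _ _ 1%E); last exact: ltry.
by rewrite -(q1 x); exact: esum_ge_term.
Qed.

Let qr1 x : \sum_(y <- s) qr x y = 1.
Proof. by rewrite sum_fine// -esum_enum// q1. Qed.

(** Outside [S] the value of [f] may be infinite, but [q x y] vanishes there because [S] is closed,
    so both sides have a zero term. *)
Lemma finite_step (f : X -> \bar R) x : (forall x, 0 <= f x)%E ->
  (forall y, S y -> f y < +oo)%E -> S x ->
  (step f x = (\sum_(y <- s) qr x y * fine (f y))%:E)%E.
Proof.
move=> f0 ffin Sx; rewrite /taboo setC0 (esum_enum us sX); last by move=> y; rewrite mule_ge0.
rewrite -sumEFin; apply: eq_bigr => y _.
have [Sy|nSy] := pselect (S y); last by rewrite q_out// mul0e mul0r.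
by rewrite EFinM !fineK// ge0_fin_numE// ffin.
Qed.

Lemma iter_step_lty (f : X -> \bar R) k : (forall x, 0 <= f x)%E ->
  (forall y, S y -> f y < +oo)%E -> forall y, S y -> (iter k step f y < +oo)%E.
Proof.
move=> f0 ffin; elim: k => //= k IH y Sy.
by rewrite finite_step ?ltry// => x; exact: iter_taboo_ge0.
Qed.

Variables (fp fn : X -> \bar R) (h : X -> R) (l : R).
Hypotheses (fp0 : forall x, (0 <= fp x)%E) (fn0 : forall x, (0 <= fn x)%E).
Hypotheses (fpS : forall x, S x -> (fp x < +oo)%E)
  (fnS : forall x, S x -> (fn x < +oo)%E).
Hypothesis poisson : forall x, S x ->
  fine (fp x) - fine (fn x) + \sum_(y <- s) qr x y * h y = l + h x.

Let a k x := fine (iter k step fp x) - fine (iter k step fn x).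
Let A N x := \sum_(k < N) a k x.

Let aS k x : S x -> a k.+1 x = \sum_(y <- s) qr x y * a k y.
Proof.
move=> Sx; rewrite /a /= !finite_step//; first 1 last.
- by move=> y; exact: iter_taboo_ge0.
- by move=> y; exact: iter_step_lty.
- by move=> y; exact: iter_taboo_ge0.
- by move=> y; exact: iter_step_lty.
by rewrite /= -sumrB; apply: eq_bigr => y _; rewrite mulrBr.
Qed.

Let AS N x : S x -> A N.+1 x = a 0 x + \sum_(y <- s) qr x y * A N y.
Proof.
move=> Sx; rewrite /A big_ord_recl/=; congr (_ + _).
under eq_bigr do rewrite aS//.
by rewrite exchange_big/=; apply: eq_bigr => y _; rewrite mulr_sumr.
Qed.

(** By the Poisson equation, the error [A N - N l - h] at [N + 1] is the [q]-average of the errors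
    at [N]. Averaging preserves the bound, and at [N = 0] the error is [- h x]. *)
Let deviation N x : S x ->
  `|A N x - N%:R * l - h x| <= \sum_(y <- s) `|h y|.
Proof.
elim: N x => [|N IH] x Sx.
  rewrite /A big_ord0 mul0r subr0 sub0r normrN (big_rem x)//=.
  by rewrite lerDl sumr_ge0.
rewrite AS//; have -> : a 0 x = l + h x - \sum_(y <- s) qr x y * h y.
  by rewrite -poisson// addrK.
have -> : l + h x - \sum_(y <- s) qr x y * h y + \sum_(y <- s) qr x y * A N y -
    N.+1%:R * l - h x = \sum_(y <- s) qr x y * (A N y - N%:R * l - h y).
  have -> : \sum_(y <- s) qr x y * (A N y - N%:R * l - h y) =
      \sum_(y <- s) qr x y * A N y - (\sum_(y <- s) qr x y) * (N%:R * l) -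
      \sum_(y <- s) qr x y * h y.
    by rewrite mulr_suml -!sumrB; apply: eq_bigr => y _; ring.
  by rewrite qr1 -natr1; ring.
set B := \sum_(y <- s) `|h y|.
have -> : B = \sum_(y <- s) qr x y * B by rewrite -mulr_suml qr1 mul1r.
apply: le_trans (ler_norm_sum _ _ _) _; apply: ler_sum => y _.
rewrite normrM ger0_norm ?fine_ge0//.
have [Sy|nSy] := pselect (S y); last by rewrite q_out// !mul0r.
by apply: ler_wpM2l; [exact: fine_ge0|exact: IH].
Qed.

Lemma poisson_cesaro x : S x ->
  N%:R^-1 * \sum_(k < N) (fine (iter k step fp x) - fine (iter k step fn x))
    @[N --> \oo] --> l.
Proof.
move=> Sx; set B := \sum_(y <- s) `|h y| + `|h x|.
have invN : (N%:R^-1 : R) @[N --> \oo] --> 0.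
  by rewrite -cvg_shiftS; exact: cvg_harmonic.
apply/cvgrPdist_le => e e0.
have : (N%:R^-1 * B : R) @[N --> \oo] --> 0 * B by apply: cvgM => //; exact: cvg_cst.
rewrite mul0r => /cvgrPdist_le/(_ e e0)[N0 _ HN0].
exists N0.+1 => // N /= N0N; have Npos : 0 < N%:R :> R by rewrite ltr0n (leq_trans _ N0N).
have := HN0 N (ltnW N0N); rewrite /= sub0r normrN => H.
apply: le_trans H; rewrite [leRHS]ger0_norm; last first.
  by apply: mulr_ge0; [rewrite invr_ge0|rewrite addr_ge0 ?sumr_ge0].
rewrite -/(A N x) distrC -[X in _ - X](mulKf (lt0r_neq0 Npos)) -mulrBr normrM.
rewrite ger0_norm ?invr_ge0//; apply: ler_wpM2l; first by rewrite invr_ge0.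
rewrite -[X in `|X|](subrK (h x)); apply: le_trans (ler_normD _ _) _.
by rewrite lerD2r deviation.
Qed.

End finite_poisson.

(** * Passage through a finite set *)

Lemma esum_range (R : realType) (X : choiceType) (n : nat) (z : 'I_n.+1 -> X)
    (f : X -> \bar R) : injective z -> (forall x, 0 <= f x)%E ->
  (\esum_(x in range z) f x = \sum_l f (z l))%E.
Proof.
move=> z_inj f0; rewrite esum_image; last by move=> x y _ _; exact: z_inj.
by rewrite (esum_enum (index_enum_uniq 'I_n.+1))// => x; rewrite mem_index_enum.
Qed.

(** If [b] is infinite, finiteness of the product forces [a = 0], and both sides are 0, [fine] being
    0 at +oo. *)
Lemma fineM_lty (R : realType) (a b : \bar R) : (0 <= a)%E -> (0 <= b)%E ->
  a \is a fin_num -> (a * b < +oo)%E -> (a * b = (fine a * fine b)%:E)%E.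
Proof.
move=> a0 b0 af ab; have [bf|] := boolP (b \is a fin_num); first by rewrite EFinM !fineK.
rewrite ge0_fin_numE// -leNgt leye_eq => /eqP bE; move: ab; rewrite bE.
have [->|an0] := eqVneq a 0%E; first by rewrite mul0e mul0r.
by rewrite gt0_muley// lt_neqAle eq_sym an0.
Qed.

Lemma ge0_addends_lty (R : realType) (a b : \bar R) : (0 <= a)%E -> (0 <= b)%E ->
  (a + b < +oo)%E -> (a < +oo)%E /\ (b < +oo)%E.
Proof.
by move=> a0 b0 ab; split; apply: le_lt_trans ab; rewrite ?leeDl ?leeDr.
Qed.

Section passage_through.
Context {R : realType} {X : choiceType}.
Variable p : X -> X -> \bar R.
Hypothesis p0 : forall x y, (0 <= p x y)%E.
Hypothesis p1 : forall x, (\esum_(y in [set: X]) p x y = 1)%E.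
Context (n : nat) (z : 'I_n.+1 -> X) (i : 'I_n.+1).
Hypothesis z_inj : injective z.
Implicit Type f : X -> \bar R.
Local Notation Z := (range z).
Local Notation excf f x := (taboo p Z (green p Z f) x).
Local Open Scope ereal_scope.

(** The cycle is over once z_i is reached, hence the value 0; [green] at z_i would start another
    cycle. *)
Definition green_after f (l : 'I_n.+1) : \bar R :=
  if l == i then 0 else green p [set z i] f (z l).

Lemma green_after_ge0 f l : (forall x, 0 <= f x) -> 0 <= green_after f l.
Proof. by move=> f0; rewrite /green_after; case: ifP => // _; exact: green_ge0. Qed.

(** After [green_split] at the first return to [Z], [green_rec] separates a first step that lands in
    [Z] from an excursion outside it. Linearity then takes the weights [green_after f l] out of the
    Green operator. *)
Lemma green_through f x : (forall x, 0 <= f x) ->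
  green p [set z i] f x < +oo ->
  green p [set z i] f x = f x + \sum_l p x (z l) * green_after f l +
    (excf f x + \sum_l excf (p ^~ (z l)) x * green_after f l).
Proof.
move=> f0 fin; have g0 := green_ge0 p0 [set z i] f0.
have a0 l : 0 <= green_after f l by exact: green_after_ge0.
pose e y := \sum_l p y (z l) * green_after f l.
have e0 y : 0 <= e y by apply: sume_ge0 => l _; rewrite mule_ge0.
have -> : green p [set z i] f x = green p Z (f \+ e) x.
  rewrite (green_split p0 (D' := Z))//; last by move=> _ ->; exists i.
  congr green; apply/funext => y /=; congr (_ + _).
  (* The point z_i removed from [Z] is put back with weight 0, so that the sum runs over all
     indices. *)
  transitivity (\esum_(w in Z)
      (p y w * if w == z i then 0 else green p [set z i] f w)).
    rewrite setDE esum_mkcondr; apply: eq_esum => w _; have [->|wz] := eqVneq w (z i).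
      by rewrite memNset ?mule0//; apply.
    by rewrite mem_set// => /eqP; rewrite (negbTE wz).
  rewrite esum_range//; last by move=> w; rewrite mule_ge0//; case: ifP.
  by apply: eq_bigr => l _; rewrite /green_after (inj_eq z_inj).
rewrite green_rec//; last by move=> y; rewrite adde_ge0.
congr (_ + _); rewrite greenD// tabooD//; [|exact: green_ge0..].
congr (_ + _); rewrite /e.
have -> : green p Z (fun y => \sum_l p y (z l) * green_after f l) =
    (fun y => \sum_l green_after f l * green p Z (p ^~ (z l)) y).
  under [X in green p Z X]eq_fun do under eq_bigr do rewrite muleC.
  rewrite (green_sum p0); last by move=> l y; rewrite mule_ge0.
  apply/funext => y; apply: eq_bigr => l _; rewrite (greenZ p0)//.
rewrite (taboo_sum p0); last first.
  by move=> l y; rewrite mule_ge0//; apply: green_ge0.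
apply: eq_bigr => l _; rewrite (tabooZ p0)//; first by rewrite muleC.
by apply: green_ge0.
Qed.

(** By [green_entry] the set [Z] is entered almost surely, either in one step or after an excursion.
    Subtracting the one-step part from this and from the row sum leaves the claim. *)
Lemma excursion_total x : green p Z (cst 1) x < +oo ->
  \sum_l excf (p ^~ (z l)) x = taboo p Z (cst 1) x.
Proof.
move=> fin; have := green_entry p0 p1 fin.
have -> : (fun y => \esum_(l in Z) p y l) = (fun y => \sum_l p y (z l)).
  by apply/funext => y; rewrite esum_range.
rewrite (green_sum p0)//.
under eq_bigr do rewrite green_rec//.
rewrite big_split/= -[X in _ = X -> _](p1 x) (esumID Z)// !setTI esum_range//.
have sf : \sum_l p x (z l) \is a fin_num.
  rewrite ge0_fin_numE ?sume_ge0// -esum_range//.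
  apply: (@le_lt_trans _ _ 1); last exact: ltry.
  by rewrite -(p1 x) [leRHS](esumID Z)// setTI leeDl// esum_ge0.
move/(congr1 (fun u => u - \sum_l p x (z l))); rewrite [LHS]addeAC subee// add0e.
rewrite [X in _ = X -> _]addeAC subee// add0e => ->.
by apply: eq_esum => y _; rewrite mule1.
Qed.

Lemma excursion_eq0 f x : taboo p Z (cst 1) x = 0 -> excf f x = 0.
Proof.
move=> t0; apply: esum1 => y Zy.
have := esum_eq0 _ t0 Zy; rewrite mule1 => ->; first by rewrite mul0e.
by move=> w _; rewrite mule1.
Qed.

(** If z_l were outside [S], then [p ^~ (z l)] would vanish on [S], and so would all its images
    under the taboo kernel, which never leads out of [S]. *)
Lemma excursion_closed (S : set X) l x : (forall y y', S y -> 0 < p y y' -> S y') ->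
  S x -> 0 < excf (p ^~ (z l)) x -> S (z l).
Proof.
move=> S_closed Sx pos; apply: contrapT => nS.
have out y : S y -> p y (z l) = 0.
  move=> Sy; apply/eqP; rewrite eq_le p0 andbT leNgt; apply/negP => H.
  exact: nS (S_closed _ _ Sy H).
have step0 (f : X -> \bar R) : (forall y, 0 <= f y) -> (forall y, S y -> f y = 0) ->
    forall y, S y -> taboo p Z f y = 0.
  move=> f0 fS y Sy; apply: esum1 => w _.
  have [Sw|nSw] := pselect (S w); first by rewrite fS// mule0.
  rewrite (_ : p y w = 0) ?mul0e//; apply/eqP; rewrite eq_le p0 andbT leNgt.
  by apply/negP => H; exact: nSw (S_closed _ _ Sy H).
have it0 k y : S y -> iter k (taboo p Z) (p ^~ (z l)) y = 0.
  elim: k y => [|k IH] y Sy; first exact: out.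
  by apply: step0 => // w; apply: iter_taboo_ge0.
move: pos; rewrite step0 ?ltxx// => y; first exact: green_ge0.
by move=> Sy; rewrite /green eseries0// => k _ _; exact: it0.
Qed.

End passage_through.

(** * Trajectories and the Markov property *)

Section integral_complements.
Local Open Scope ereal_scope.
Context d (T : measurableType d) (R : realType).

Lemma integral_mrestr (mu : {measure set T -> \bar R}) (G : set T)
    (mG : measurable G) (f : T -> \bar R) :
  measurable_fun setT f -> (forall x, 0 <= f x) ->
  \int[mrestr mu mG]_x f x = \int[mu]_(x in G) f x.
Proof.
move=> mf f0; rewrite -(setUv G) ge0_integral_setU//; last 3 first.
- exact: measurableC.
- by rewrite setUv.
- by rewrite disj_set2E setICr.
rewrite [X in _ + X](eq_measure_integral mzero); last first.
  move=> A mA AG; rewrite /= /mrestr (_ : _ `&` _ = set0) ?measure0//.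
  by apply/seteqP; split => // x [/AG].
rewrite integral_measure_zero adde0; apply: eq_measure_integral => A mA AG.
by rewrite /= /mrestr; congr (mu _); apply/setIidPl.
Qed.

Lemma integral_fibres (X : countType) (mu : {measure set T -> \bar R})
    (v : T -> X) (mv : forall y, measurable [set w | v w = y]) (G : set T)
    (f : T -> \bar R) : measurable G -> measurable_fun G f ->
  (forall w, 0 <= f w) ->
  \int[mu]_(w in G) f w =
  \esum_(y in [set: X]) \int[mu]_(w in G `&` [set w | v w = y]) f w.
Proof.
move=> mG mf f0.
(* Fibres are indexed by codes of states, for countable additivity over [nat]; a number that encodes
   no state gives the empty fibre. *)
pose F n := G `&` [set w | pickle (v w) = n].
have Fp y : F (pickle y) = G `&` [set w | v w = y].
  rewrite /F; congr (_ `&` _); apply/seteqP; split=> w /= => [|-> //].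
  exact: (pcan_inj pickleK).
have F0 n : ~ range (@pickle X) n -> F n = set0.
  by move=> np; apply/seteqP; split=> w // -[_ /= nw]; apply: np; exists (v w).
have mF n : measurable (F n).
  have [[y _ <-]|np] := pselect (range (@pickle X) n); last by rewrite F0.
  by rewrite Fp; exact: measurableI.
have GE : G = \bigcup_n F n.
  apply/seteqP; split=> [w Gw|w [n _ []//]].
  by exists (pickle (v w)).
rewrite [in LHS]GE ge0_integral_bigcup//; last 2 first.
- by rewrite -GE.
- by move=> m n _ _ [w [[_ /= <-] [_ /= <-]]].
rewrite nneseries_esumT; last by move=> n; exact: integral_ge0.
rewrite (esumID (range (@pickle X))); last by move=> n _; exact: integral_ge0.
rewrite !setTI [X in _ + X]esum1 ?adde0; last first.
  by move=> n np; rewrite F0// integral_set0.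
rewrite (esum_image setT); last by move=> x y _ _; exact: (pcan_inj pickleK).
by apply: eq_esum => y _; rewrite Fp.
Qed.

End integral_complements.

Section trajectory_measurability.
Context (X : pcountType) d (A : measurableType d).

Lemma measurable_historyW p q p' q' (G : set (nat -> X * A)) :
  (p <= p')%N -> (q <= q')%N ->
  measurable (G : set (history X A p q)) -> measurable (G : set (history X A p' q')).
Proof.
move=> pp qq; apply: sub_sigma_algebra2 => U [[m [i [mp ->]]]|[m [B [mq mB ->]]]].
- by left; exists m, i; split => //; exact: leq_trans mp _.
- by right; exists m, B; split => //; exact: leq_trans mq _.
Qed.

Lemma measurable_history_traj p q (G : set (nat -> X * A)) :
  measurable (G : set (history X A p q)) -> measurable (G : set (traj X A)).
Proof.
move=> /(measurable_historyW (leq_maxl p q) (leq_maxr p q)).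
by apply: sub_sigma_algebra2 => U HU; exists (maxn p q).
Qed.

Lemma measurable_history_state p q k (S : set X) : (k < p)%N ->
  measurable ([set w | S (w k).1] : set (history X A p q)).
Proof.
move=> kp; have -> : [set w | S (w k).1] =
    \bigcup_y [set w : history X A p q | (w k).1 = y /\ S y].
  by apply/seteqP; split=> [w Sw|w [y _ [/= -> //]]]; exists (w k).1.
apply: countable_bigcupT_measurable; first exact: countableP.
move=> y; have [Sy|nSy] := pselect (S y).
  apply: sub_sigma_algebra; left; exists k, y; split=> //.
  by apply/seteqP; split=> w // [].
by rewrite (_ : mkset _ = set0)//; apply/seteqP; split=> w // [].
Qed.

Lemma measurable_history_action p q k B : (k < q)%N -> measurable B ->
  measurable ([set w | B (w k).2] : set (history X A p q)).
Proof. by move=> kq mB; apply: sub_sigma_algebra; right; exists k, B. Qed.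

Lemma measurable_state k (S : set X) :
  measurable ([set w | S (w k).1] : set (traj X A)).
Proof.
exact: (measurable_history_traj (measurable_history_state (q := 0%N) S (ltnSn k))).
Qed.

Lemma measurable_action k : measurable_fun setT (fun w : traj X A => (w k).2).
Proof.
move=> _ B mB; rewrite setTI.
exact: (measurable_history_traj (measurable_history_action (p := 0%N) (ltnSn k) mB)).
Qed.

Lemma measurable_state_action d' (T : measurableType d') (f : X -> A -> T) k :
  (forall x, measurable_fun setT (f x)) ->
  measurable_fun setT (fun w : traj X A => f (w k).1 (w k).2).
Proof.
move=> mf _ Y mY; rewrite setTI.
have -> : (fun w : traj X A => f (w k).1 (w k).2) @^-1` Y =
    \bigcup_y ([set w : traj X A | (w k).1 = y] `&` [set w | f y (w k).2 \in Y]).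
  apply/seteqP; split=> [w Yw|w [y _ [/= <-]]].
    by exists (w k).1 => //; split => //=; rewrite inE.
  by rewrite inE.
apply: countable_bigcupT_measurable; first exact: countableP.
move=> y; apply: measurableI; first exact: (measurable_state k [set y]).
have := measurableT_comp (mf y) (measurable_action k) measurableT mY.
rewrite setTI; congr measurable; apply/seteqP; split => w /=; by rewrite inE.
Qed.

(** The constraint bears on the [r] times after [k] and not on [k] itself, in accordance with
    [taboo], which tests a state only after a step. *)
Definition avoid (D : set X) k r : set (nat -> X * A) :=
  [set w | forall m, (k < m <= k + r)%N -> ~ D (w m).1].

Lemma avoid0 D k : avoid D k 0 = setT.
Proof.
by apply/seteqP; split=> // w _ m /andP[km]; rewrite addn0 leqNgt km.
Qed.

Lemma avoidS D k r :
  avoid D k r.+1 = [set w | ~ D (w k.+1).1] `&` avoid D k.+1 r.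
Proof.
apply/seteqP; split=> w /=.
  move=> H; split; first by apply: H; rewrite ltnSn addnS ltnS leq_addr.
  by move=> m /andP[km mk]; apply: H; rewrite (ltnW km) -addSnnS.
move=> [H1 H2] m /andP[]; rewrite leq_eqVlt => /predU1P[<-//|km] mk.
by apply: H2; rewrite km addSnnS.
Qed.

Lemma measurable_history_avoid D k r p q : (k + r < p)%N ->
  measurable (avoid D k r : set (history X A p q)).
Proof.
elim: r k => [|r IH] k; first by rewrite avoid0 => _; exact: measurableT.
rewrite addnS -addSn => krp; rewrite avoidS; apply: measurableI; last exact: IH.
apply: (measurable_history_state (~` D)).
by rewrite (leq_ltn_trans _ krp)// leq_addr.
Qed.

Lemma measurable_avoid D k r : measurable (avoid D k r : set (traj X A)).
Proof.
exact: (measurable_history_traj (measurable_history_avoid (q := 0%N) D (ltnSn (k + r)))).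
Qed.

End trajectory_measurability.

Section markov_property.
Context (R : realType) (X : pcountType) d (A : measurableType d).
Variables (M : mdp R X A) (sigma : X -> probability A R).
Hypothesis sM : stationary M sigma.
Local Open Scope ereal_scope.
Local Notation p := (mean_trans M sigma).

Definition mean (f : X -> A -> \bar R) (x : X) := \int[sigma x]_a f x a.

Lemma mean_ge0 f : (forall x a, 0 <= f x a) -> forall x, 0 <= mean f x.
Proof. by move=> f0 x; exact: integral_ge0. Qed.

(** Off the action sets [trans] may be negative, but a stationary policy charges only admissible
    actions. *)
Lemma mean_trans_neg x y :
  \int[sigma x]_a ((fun a => (trans M x a y)%:E)^\- a) = 0.
Proof.
rewrite -[RHS](integral0 (sigma x) setT); apply: ge0_ae_eq_integral => //.
  by apply: measurable_funeneg; apply/measurable_EFinP; exact: measurable_trans.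
have [N [mN N0 subN]] := sM x; exists N; split => // a na; apply: subN => xa.
apply: na => _; rewrite funenegE; apply/max_idPr.
by rewrite leeNl oppe0 lee_fin trans_ge0.
Qed.

Lemma mean_transE x y :
  p x y = \int[sigma x]_a ((fun a => (trans M x a y)%:E)^\+ a).
Proof. by rewrite /mean_trans integralE mean_trans_neg sube0. Qed.

Lemma mean_trans_ge0 x y : 0 <= p x y.
Proof. by rewrite mean_transE integral_ge0. Qed.

Section one_law.
Context (x : X) (Q : probability (traj X A) R).
Hypothesis Qx : path_law M (markov_rule sigma) x Q.

Let at_state k y : set (traj X A) := [set w | (w k).1 = y].

Let m_at_state k y : measurable (at_state k y).
Proof. exact: (measurable_state k [set y]). Qed.

(** By [path_law_act], the image under a_k of [Q] restricted to the event is a multiple of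
    [sigma y]; the formula for events thereby extends to functions of the action. *)
Lemma law_act k (G : set (nat -> X * A)) y (f : A -> \bar R) :
  measurable (G : set (history X A k.+1 k)) ->
  measurable_fun setT f -> (forall a, 0 <= f a) ->
  \int[Q]_(w in G `&` at_state k y) f (w k).2 =
  Q (G `&` at_state k y) * \int[sigma y]_a f a.
Proof.
move=> mG mf f0.
have mG' : measurable (G `&` at_state k y : set (history X A k.+1 k)).
  by apply: measurableI => //; exact: (measurable_history_state [set y] (ltnSn k)).
have mG't := measurable_history_traj mG'.
have mfk : measurable_fun setT (fun w : traj X A => f (w k).2).
  exact: (measurableT_comp mf (measurable_action k)).
rewrite -(integral_mrestr _ mG't)//.
have := @ge0_integral_pushforward _ _ _ _ R _ (measurable_action k)
  (mrestr Q mG't) setT f measurableT mf (fun a _ => f0 a).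
rewrite preimage_setT /comp => <-.
have fQ : Q (G `&` at_state k y) \is a fin_num by exact: fin_num_measure.
have Q0 : (0 <= fine (Q (G `&` at_state k y)))%R by exact: fine_ge0.
rewrite (eq_measure_integral (mscale (NngNum Q0) (sigma y))); last first.
  move=> mk B mB _; rewrite /= /pushforward /mrestr /mscale/= fineK// setIC.
  rewrite -[LHS]/(Q ((G `&` at_state k y) `&` [set w | B (w k).2])).
  rewrite (path_law_act Qx mG' mB).
  rewrite (eq_integral (fun=> sigma y B)); last first.
    by move=> w; rewrite inE => -[_ <-].
  by rewrite integral_cst// muleC.
  exact: measurable_action.
by rewrite ge0_integral_mscale//= fineK.
Qed.

Lemma law_trans k (G : set (nat -> X * A)) y y' :
  measurable (G : set (history X A k.+1 k)) ->
  Q (G `&` at_state k y `&` at_state k.+1 y') = Q (G `&` at_state k y) * p y y'.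
Proof.
move=> mG.
have mG' : measurable (G `&` at_state k y : set (history X A k.+1 k)).
  by apply: measurableI => //; exact: (measurable_history_state [set y] (ltnSn k)).
rewrite (path_law_trans Qx y' (measurable_historyW (leqnn _) (leqnSn k) mG')).
pose g a := (trans M y a y')%:E.
have mg : measurable_fun setT g by apply/measurable_EFinP; exact: measurable_trans.
rewrite (eq_integral (fun w : traj X A => g (w k).2)); last first.
  by move=> w; rewrite inE /g => -[_ <-].
rewrite integralE.
rewrite (eq_integral (fun w : traj X A => g^\+ (w k).2)); last first.
  by move=> w _; rewrite !funeposE.
rewrite [X in _ - X](eq_integral (fun w : traj X A => g^\- (w k).2)); last first.
  by move=> w _; rewrite !funenegE.
rewrite (law_act y mG (measurable_funepos mg))//.
rewrite (law_act y mG (measurable_funeneg mg))//.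
by rewrite mean_trans_neg mule0 sube0 mean_transE.
Qed.

(* The Markov property at time k. *)
Lemma law_avoid D f r k (G : set (nat -> X * A)) y :
  (forall x, measurable_fun setT (f x)) -> (forall x a, 0 <= f x a) ->
  measurable (G : set (history X A k.+1 k)) ->
  \int[Q]_(w in G `&` at_state k y `&` avoid D k r) f (w (k + r)%N).1 (w (k + r)%N).2 =
  Q (G `&` at_state k y) * iter r (taboo p D) (mean f) y.
Proof.
move=> mf f0; elim: r k G y => [|r IH] k G y mG.
  rewrite avoid0 setIT addn0 /mean -law_act//.
  by apply: eq_integral => w; rewrite inE => -[_ <-].
have mG' : measurable (G `&` at_state k y : set (history X A k.+1 k)).
  by apply: measurableI => //; exact: (measurable_history_state [set y] (ltnSn k)).
have mG2 := measurable_historyW (leqnSn _) (leqnSn k) mG'.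
have mfk : measurable_fun setT
    (fun w : traj X A => f (w (k + r.+1)%N).1 (w (k + r.+1)%N).2).
  exact: measurable_state_action.
rewrite (@integral_fibres _ _ _ _ Q (fun w => (w k.+1).1))//; last 3 first.
- by move=> z; exact: m_at_state.
- apply: measurableI; last exact: measurable_avoid.
  exact: measurable_history_traj mG'.
- exact: measurable_funTS.
rewrite [RHS]/= {2}/taboo -esumZl//; last first.
  move=> z; rewrite mule_ge0 ?mean_trans_ge0//.
  by apply: iter_taboo_ge0; [exact: mean_trans_ge0|exact: mean_ge0].
rewrite [LHS](esumID D); last by move=> z _; exact: integral_ge0.
rewrite !setTI esum1 ?add0e; last first.
  move=> z Dz; rewrite (_ : _ `&` _ = set0) ?integral_set0//.
  apply/seteqP; split => // w [[_]]; rewrite avoidS => -[/= nD _] E.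
  by apply: nD; rewrite E.
apply: eq_esum => z nDz.
rewrite muleA -law_trans//.
rewrite (_ : _ `&` [set w | _] = G `&` at_state k y `&` at_state k.+1 z `&` avoid D k.+1 r).
  by under eq_integral do rewrite -addSnnS; exact: IH.
rewrite avoidS; apply/seteqP; split => w /=; rewrite /at_state/=.
  by move=> [[[? ?] [? ?]] ?].
by move=> [[[? ?] E] ?]; rewrite E.
Qed.

Lemma integral_init (G : set (traj X A)) f : measurable G ->
  measurable_fun setT f -> (forall w, 0 <= f w) ->
  \int[Q]_(w in G) f w = \int[Q]_(w in G `&` at_state 0 x) f w.
Proof.
move=> mG mf f0.
have mG1 := measurableI _ _ mG (m_at_state 0 x).
have mG2 := measurableI _ _ mG (measurableC (m_at_state 0 x)).
rewrite -{1}(setIT G) -(setUv (at_state 0 x)) setIUr ge0_integral_setU//; last 2 first.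
- exact: measurable_funTS.
- by rewrite disj_set2E -setIIr setICr setI0.
rewrite [X in _ + X]null_set_integral ?adde0//; first exact: measurable_funTS.
apply: (subset_measure0 (B := ~` at_state 0 x)) => //; first exact: measurableC.
by have := probability_setC Q (m_at_state 0 x); rewrite [X in _ - X](path_law_init Qx) subee.
Qed.

End one_law.
End markov_property.

(** * Costs up to random times *)

Section null_sets.
Context d (T : measurableType d) (R : realType).
Variable mu : {measure set T -> \bar R}.
Local Open Scope ereal_scope.
Import HBNNSimple.

(* Neither function is assumed measurable: the integrand of [cost_until] for a
   signed cost is a limit that need not exist everywhere. *)
Lemma ge0_integral_eq_off_null (N : set T) (f g : T -> \bar R) :
  measurable N -> mu N = 0 -> (forall x, 0 <= f x) -> (forall x, 0 <= g x) ->
  (forall x, ~ N x -> f x = g x) -> \int[mu]_x f x = \int[mu]_x g x.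
Proof.
move=> mN N0; have le f' g' : (forall x, 0 <= f' x) -> (forall x, 0 <= g' x) ->
    (forall x, ~ N x -> f' x = g' x) -> \int[mu]_x f' x <= \int[mu]_x g' x.
  move=> f0 g0 fg; rewrite [leLHS]ge0_integralTE// [leRHS]ge0_integralTE//.
  (* The simple function [h] below [f'] is cut to 0 on [N]: the result lies below [g'] everywhere
     and has the same integral. *)
  apply: ge_ereal_sup => _ [h hf <-]; pose h' := proj_nnsfun h (measurableC mN).
  apply: ereal_sup_ubound; exists h'.
    move=> x; rewrite /h'/= mindicE; have [xN|_] := boolP (x \in ~` N).
      by rewrite mulr1 -fg; [exact: hf|rewrite inE in xN].
    by rewrite mulr0.
  rewrite -!integralT_nnsfun; apply: ge0_ae_eq_integral => //.
  - exact/measurable_EFinP.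
  - exact/measurable_EFinP.
  - by move=> x _; rewrite lee_fin.
  - by move=> x _; rewrite lee_fin.
  - exists N; split => // x /= /not_implyP[_ hx]; apply: contrapT => nN; apply: hx.
    by rewrite /h'/= mindicE mem_set// mulr1.
by move=> f0 g0 fg; apply/eqP; rewrite eq_le !le// => x /fg.
Qed.

Lemma integral_eq_off_null (N : set T) (f g : T -> \bar R) :
  measurable N -> mu N = 0 -> (forall x, ~ N x -> f x = g x) ->
  \int[mu]_x f x = \int[mu]_x g x.
Proof.
move=> mN N0 fg; rewrite integralE [RHS]integralE.
congr (_ - _); apply: (ge0_integral_eq_off_null mN N0) => // x /fg E.
- by rewrite !funeposE E.
- by rewrite !funenegE E.
Qed.

End null_sets.

Section first_times.
Context {R : realType}.
Local Open Scope ereal_scope.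

Lemma lt_first_time (E : set nat) k :
  k%:R%:E < first_time E :> \bar R <-> forall m, (m <= k)%N -> ~ E m.
Proof.
split=> [kE m mk Em|H].
  have : first_time E <= m%:R%:E :> \bar R by apply: ereal_inf_lbound; exists m.
  by move=> /(lt_le_trans kE); rewrite lte_fin ltr_nat ltnNge mk.
apply: (@lt_le_trans _ _ k.+1%:R%:E); first by rewrite lte_fin ltr_nat.
apply: le_ereal_inf_tmp => _ [j Ej <-]; rewrite lee_fin ler_nat ltnNge.
by apply/negP => /H; apply.
Qed.

Lemma first_time_eq (E : set nat) k :
  first_time E = k%:R%:E :> \bar R <-> E k /\ forall m, (m < k)%N -> ~ E m.
Proof.
split=> [H|[Ek H]].
  have H2 m : (m < k)%N -> ~ E m.
    move=> mk; have : m%:R%:E < first_time E :> \bar R by rewrite H lte_fin ltr_nat.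
    by move/lt_first_time => /(_ m (leqnn m)).
  split => //; apply: contrapT => nEk.
  have : k%:R%:E < first_time E :> \bar R.
    apply/lt_first_time => m; rewrite leq_eqVlt => /predU1P[->//|]; exact: H2.
  by rewrite H ltxx.
apply/eqP; rewrite eq_le; apply/andP; split.
  by apply: ereal_inf_lbound; exists k.
apply: le_ereal_inf_tmp => _ [j Ej <-]; rewrite lee_fin ler_nat leqNgt.
by apply/negP => /H; apply.
Qed.

(** A time is the number of integers below it. This turns mean times into expected costs at unit
    rate. *)
Lemma first_time_series (E : set nat) :
  \sum_(0 <= k <oo | k%:R%:E < (first_time E : \bar R)) 1 = first_time E :> \bar R.
Proof.
have [[k Ek]|E0] := pselect (exists k, E k).
  have EX : exists k, `[< E k >] by exists k; exact/asboolP.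
  case: (ex_minnP EX) => m /asboolP Em mmin.
  have mE : first_time E = m%:R%:E :> \bar R.
    apply/first_time_eq; split=> // j jm Ej.
    by have := mmin j (asboolT Ej); rewrite leqNgt jm.
  rewrite mE eseries_mkcond (nneseries_split _ m)//; last by move=> j _; case: ifP.
  rewrite add0n [X in _ + X]eseries0 ?adde0; last first.
    by move=> j mj _; rewrite lte_fin ltr_nat ltnNge mj.
  rewrite (eq_big_nat _ _ (F2 := fun=> 1)); last first.
    by move=> j /andP[_ jm]; rewrite lte_fin ltr_nat jm.
  by rewrite sumEFin big_const_nat subn0 iter_addr_0.
have -> : E = set0 by apply/seteqP; split=> // k Ek; apply: E0; exists k.
rewrite /first_time image_set0 ereal_inf0.
apply/eq_infty => y.
have -> : \sum_(0 <= k <oo | k%:R%:E < +oo :> \bar R) 1 = \sum_(0 <= k <oo) 1 :> \bar R.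
  by apply: eq_eseriesl => k; rewrite ltry.
apply: (@le_trans _ _ (\sum_(0 <= k < Num.bound `|y|%R) 1)); last first.
  exact: nneseries_lim_ge.
rewrite sumEFin big_const_nat subn0 iter_addr_0 lee_fin.
by rewrite (le_trans (ler_norm y))// ltW// archi_boundP.
Qed.

End first_times.

Section cost_until_theory.
Context (R : realType) (X : pcountType) d (A : measurableType d).
Variables (Q : probability (traj X A) R) (nu : traj X A -> \bar R).
Hypothesis mnu : forall k, measurable [set w | (k%:R%:E < nu w)%E].
Implicit Type f : X -> A -> R.

Definition pos_part f x a := Num.max (f x a) 0.
Definition neg_part f x a := Num.max (- f x a) 0.

Lemma pos_part_ge0 f x a : 0 <= pos_part f x a.
Proof. by rewrite le_max lexx orbT. Qed.

Lemma neg_part_ge0 f x a : 0 <= neg_part f x a.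
Proof. by rewrite le_max lexx orbT. Qed.

Lemma measurable_pos_part f : (forall x, measurable_fun setT (f x)) ->
  forall x, measurable_fun setT (pos_part f x).
Proof. by move=> mf x; apply: measurable_maxr. Qed.

Lemma measurable_neg_part f : (forall x, measurable_fun setT (f x)) ->
  forall x, measurable_fun setT (neg_part f x).
Proof. by move=> mf x; apply: measurable_maxr => //; exact: measurableT_comp. Qed.

Local Open Scope ereal_scope.

Let term f k (w : traj X A) : \bar R := (f (w k).1 (w k).2)%:E.

Let partial f (w : traj X A) : \bar R :=
  \sum_(0 <= k <oo | k%:R%:E < nu w) term f k w.

Let m_term f k : (forall x, measurable_fun setT (f x)) ->
  measurable_fun setT (term f k \_ [set w | k%:R%:E < nu w]).
Proof.
move=> mf; apply/(measurable_restrictT _ (mnu k)); apply: measurable_funTS.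
apply/measurable_EFinP; exact: measurable_state_action.
Qed.

Let partialE f w :
  partial f w = \sum_(0 <= k <oo) (term f k \_ [set w | k%:R%:E < nu w]) w.
Proof.
rewrite /partial eseries_mkcond; apply: eq_eseriesr => k _; rewrite /patch.
by case: ifPn => [nuk|nuk]; [rewrite mem_set|rewrite memNset//; exact/negP].
Qed.

Let m_partial f : (forall x, measurable_fun setT (f x)) ->
  (forall x a, (0 <= f x a)%R) -> measurable_fun setT (partial f).
Proof.
move=> mf f0; rewrite (funext (partialE f)).
apply: ge0_emeasurable_sum => [k w _ _|k _]; last exact: m_term.
by rewrite /patch; case: ifP => // _; rewrite lee_fin.
Qed.

Lemma cost_until_series f : (forall x, measurable_fun setT (f x)) ->
  (forall x a, (0 <= f x a)%R) ->
  cost_until f Q nu =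
  \sum_(0 <= k <oo) \int[Q]_(w in [set w | k%:R%:E < nu w]) (f (w k).1 (w k).2)%:E.
Proof.
move=> mf f0; rewrite /cost_until -/(partial f).
under eq_integral do rewrite -/(partial f _) partialE.
rewrite integral_nneseries//; first last.
- by move=> k w _; rewrite /patch; case: ifP => // _; rewrite lee_fin.
- by move=> k; exact: m_term.
by apply: eq_eseriesr => k _; rewrite -integral_mkcond.
Qed.

(** The sum of [|f|] is integrable, hence finite off a null set, where the inner series converges
    absolutely and splits. On the null set nothing is known, which is why [integral_eq_off_null] is
    used. *)
Lemma cost_until_signed f : (forall x, measurable_fun setT (f x)) ->
  cost_until (fun x a => `|f x a|%R) Q nu < +oo ->
  cost_until f Q nu = cost_until (pos_part f) Q nu - cost_until (neg_part f) Q nu.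
Proof.
move=> mf fin.
have mabs x : measurable_fun setT (fun a => `|f x a|%R) by exact: measurableT_comp.
have pE (g : X -> A -> R) w : (forall x a, (0 <= g x a)%R) -> 0 <= partial g w.
  by move=> g0; apply: nneseries_ge0 => k _ _; rewrite lee_fin.
have le_abs (g : X -> A -> R) : (forall x a, (0 <= g x a <= `|f x a|)%R) -> forall w,
    partial g w <= partial (fun x a => `|f x a|%R) w.
  by move=> gf w; apply: lee_nneseries => k _ *; rewrite lee_fin;
    have /andP[] := gf (w k).1 (w k).2.
have int (g : X -> A -> R) : (forall x, measurable_fun setT (g x)) ->
    (forall x a, (0 <= g x a <= `|f x a|)%R) -> Q.-integrable setT (partial g).
  move=> mg gf; have g0 x a : (0 <= g x a)%R by have /andP[] := gf x a.
  apply/integrableP; split; first by apply: m_partial.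
  under eq_integral => w _ do rewrite gee0_abs ?pE//.
  apply: le_lt_trans fin; apply: ge0_le_integral => //.
  - by move=> w _; exact: pE.
  - by apply: m_partial.
  - exact: (m_partial mabs (fun x a => normr_ge0 _)).
  - by move=> w _; exact: le_abs.
have i1 : Q.-integrable setT (partial (fun x a => `|f x a|%R)).
  by apply: int => // x a; rewrite normr_ge0 lexx.
have i2 : Q.-integrable setT (partial (pos_part f)).
  apply: int; first exact: measurable_pos_part.
  by move=> x a; rewrite pos_part_ge0 ge_max ler_norm normr_ge0.
have i3 : Q.-integrable setT (partial (neg_part f)).
  apply: int; first exact: measurable_neg_part.
  by move=> x a; rewrite neg_part_ge0 ge_max -normrN ler_norm normr_ge0.
rewrite /cost_until -integralB//.
have [N [mN N0 subN]] := integrable_ae measurableT i1.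
apply: (integral_eq_off_null mN N0) => w nN.
have : partial (fun x a => `|f x a|%R) w \is a fin_num.
  by apply: contrapT => H; apply: nN; apply: subN => /(_ I).
rewrite ge0_fin_numE ?pE// => pfin.
rewrite [LHS]summable_eseries; last first.
  rewrite /summable -nneseries_esum//; exact: pfin.
congr (_ - _); apply: eq_eseriesr => k _.
- by rewrite funeposE /pos_part EFin_max.
- by rewrite funenegE /neg_part EFin_max.
Qed.

End cost_until_theory.

(** * Exit, entry and return times as events of finite horizon *)

Section random_time_events.
Context (R : realType) (X : pcountType) d (A : measurableType d).
Local Open Scope ereal_scope.
Implicit Type w : traj X A.

Lemma avoid_shift (D : set X) k r w m : avoid D k r w -> (k <= m)%N ->
  avoid D m (k + r - m) w.
Proof.
move=> H km j /andP[mj]; have [mr|rm] := leqP m (k + r).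
  by rewrite subnKC// => jr; apply: H; rewrite (leq_ltn_trans km).
by move: rm => /ltnW; rewrite -subn_eq0 => /eqP ->; rewrite addn0 leqNgt mj.
Qed.

Lemma lt_return_time y k w :
  k%:R%:E < return_time y w :> \bar R <-> avoid [set y] 0 k w.
Proof.
split=> [/lt_first_time H m /andP[m0 mk] E|H].
  by apply: (H m); rewrite ?add0n in mk *.
by apply/lt_first_time => m mk [m0 E]; apply: (H m) => //; rewrite m0 add0n.
Qed.

Lemma exit_time_eq (Z : set X) k w :
  exit_time Z w = k%:R%:E :> \bar R <->
  ~ Z (w k).1 /\ forall m, (m < k)%N -> Z (w m).1.
Proof.
split=> [/first_time_eq[Zk H]|[Zk H]]; first by split=> // m /H/contrapT.
by apply/first_time_eq; split=> // m /H Zm.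
Qed.

Lemma exit_time_lt (Z : set X) k w :
  exit_time Z w < k%:R%:E :> \bar R <-> exists2 j, (j < k)%N & ~ Z (w j).1.
Proof.
split=> [ek|[j jk Zj]].
  apply: contrapT => H; have : k%:R%:E <= exit_time Z w :> \bar R.
    case: k ek H => [|k] ek H.
      by apply: le_ereal_inf_tmp => _ [j _ <-]; rewrite lee_fin.
    apply: le_ereal_inf_tmp => _ [j Zj <-]; rewrite lee_fin ler_nat leqNgt.
    by apply/negP => jk; apply: H; exists j.
  by move=> /(lt_le_trans ek); rewrite ltxx.
apply: (@le_lt_trans _ _ j%:R%:E); last by rewrite lte_fin ltr_nat.
by apply: ereal_inf_lbound; exists j.
Qed.

(** Any time spent outside [Z] may stand for the exit time here; quantifying over all of them
    presents the event as an intersection of measurable ones. *)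
Lemma lt_entry_time (Z : set X) k w :
  k%:R%:E < entry_time Z w :> \bar R <->
  forall j, (j <= k)%N -> ~ Z (w j).1 -> avoid Z j (k - j) w.
Proof.
split=> [/lt_first_time H j jk Zj m /andP[jm]|H].
  rewrite subnKC// => mk Zm; apply: (H m mk); split=> //.
  by apply/exit_time_lt; exists j.
apply/lt_first_time => m mk [/exit_time_lt[j jm Zj] Zm].
have jk := leq_trans (ltnW jm) mk.
by apply: (H j jk Zj m) => //; rewrite jm subnKC.
Qed.

Lemma lt_entry_time_outside (Z : set X) k w : ~ Z (w 0%N).1 ->
  k%:R%:E < entry_time Z w :> \bar R <-> avoid Z 0 k w.
Proof.
move=> Z0; split=> [/lt_entry_time/(_ 0%N (leq0n k) Z0)|H].
  by rewrite subn0.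
by apply/lt_entry_time => j jk _; have := avoid_shift H (leq0n j).
Qed.

(** The set [avoid Z k (K.-1 - k)] concerns the times [k + 1] to [K - 1]; at time [k] the path is
    outside [Z] by definition of the exit time. *)
Lemma entry_time_eq (Z : set X) k K w : exit_time Z w = k%:R%:E :> \bar R ->
  entry_time Z w = K%:R%:E :> \bar R <->
  [/\ (k < K)%N, Z (w K).1 & avoid Z k (K.-1 - k) w].
Proof.
move=> ek; rewrite /entry_time first_time_eq /= ek.
split=> [[[kK ZK] H]|[kK ZK H]].
  move: kK; rewrite lte_fin ltr_nat => kK; split=> // m /andP[km].
  rewrite subnKC; last by rewrite -ltnS prednK// (leq_trans _ kK).
  rewrite -ltnS prednK; last by rewrite (leq_trans _ kK).
  by move=> mK Zm; apply: (H m mK); rewrite lte_fin ltr_nat.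
split=> [|m mK [km Zm]]; first by rewrite lte_fin ltr_nat.
move: km; rewrite lte_fin ltr_nat => km.
apply: (H m) => //; rewrite km subnKC//.
  by rewrite -ltnS prednK// (leq_trans _ kK).
by rewrite -ltnS prednK// (leq_trans _ kK).
Qed.

Lemma measurable_lt_return_time y k :
  measurable [set w : traj X A | k%:R%:E < return_time y w :> \bar R].
Proof.
rewrite (_ : mkset _ = avoid [set y] 0 k); first exact: measurable_avoid.
by apply/seteqP; split=> w /lt_return_time.
Qed.

Lemma measurable_lt_entry_time (Z : set X) k :
  measurable [set w : traj X A | k%:R%:E < entry_time Z w :> \bar R].
Proof.
rewrite (_ : mkset _ = \bigcap_j [set w : traj X A | (j <= k)%N ->
    ~ Z (w j).1 -> avoid Z j (k - j) w]); last first.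
  apply/seteqP; split=> [w /lt_entry_time H j _|w H]; first exact: H.
  by apply/lt_entry_time => j; exact: (H j I).
apply: bigcapT_measurable => j.
have [jk|kj] := leqP j k; last first.
  by rewrite (_ : mkset _ = setT)//; apply/seteqP; split.
rewrite (_ : mkset _ = [set w : traj X A | Z (w j).1] `|` avoid Z j (k - j)).
  by apply: measurableU; [exact: measurable_state|exact: measurable_avoid].
apply/seteqP; split=> w /=.
  by move=> /(_ isT) H; have [|/H] := pselect (Z (w j).1); [left|right].
by move=> [|].
Qed.

End random_time_events.

(** * Expected costs under the path law as Green functions *)

Section costs_and_green.
Context (R : realType) (X : pcountType) d (A : measurableType d).
Variables (M : mdp R X A) (sigma : X -> probability A R).
Hypothesis sM : stationary M sigma.
Local Open Scope ereal_scope.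
Local Notation p := (mean_trans M sigma).

Definition mean_cost_rate (f : X -> A -> R) := mean sigma (fun x a => (f x a)%:E).

Lemma mean_cost_rate_ge0 f : (forall x a, (0 <= f x a)%R) ->
  forall x, 0 <= mean_cost_rate f x.
Proof. by move=> f0; apply: mean_ge0 => x a; rewrite lee_fin. Qed.

Lemma mean_cst (f : X -> \bar R) : mean sigma (fun x _ => f x) = f.
Proof.
apply/funext => x; rewrite /mean integral_cst//.
by rewrite [X in _ * X]probability_setT mule1.
Qed.

Section one_law.
Context (x : X) (Q : probability (traj X A) R).
Hypothesis Qx : path_law M (markov_rule sigma) x Q.

Lemma law_start : Q [set w | (w 0%N).1 = x] = 1.
Proof. exact: path_law_init Qx. Qed.

Lemma law_avoid0 D f k : (forall x, measurable_fun setT (f x)) ->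
  (forall x a, 0 <= f x a) ->
  \int[Q]_(w in avoid D 0 k) f (w k).1 (w k).2 = iter k (taboo p D) (mean sigma f) x.
Proof.
move=> mf f0; rewrite (integral_init Qx)//; last 2 first.
- exact: measurable_avoid.
- exact: measurable_state_action.
have := law_avoid sM Qx D k x mf f0 (k := 0) (G := setT) measurableT.
by rewrite !setTI law_start mul1e add0n setIC.
Qed.

(** The [k]-th term of the cost series is an expectation over paths that avoid [D] up to [k], which
    is the [k]-th term of the Green series. The description of [nu] is required only for paths from
    [x], since the entry time is a first visit to [Z] only when the path starts outside [Z]. *)
Lemma cost_until_green D (nu : traj X A -> \bar R) (f : X -> A -> R) :
  (forall k, measurable [set w | k%:R%:E < nu w]) ->
  (forall w k, (w 0%N).1 = x -> k%:R%:E < nu w <-> avoid D 0 k w) ->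
  (forall x, measurable_fun setT (f x)) -> (forall x a, (0 <= f x a)%R) ->
  cost_until f Q nu = green p D (mean_cost_rate f) x.
Proof.
move=> mnu nuE mf f0; rewrite cost_until_series//; apply: eq_eseriesr => k _.
have mf' y : measurable_fun setT (fun a => (f y a)%:E) by exact/measurable_EFinP.
have f0' y a : 0 <= (f y a)%:E by rewrite lee_fin.
rewrite -(law_avoid0 D k mf' f0') (integral_init Qx)//; last first.
  exact: (measurable_state_action _ mf').
rewrite [RHS](integral_init Qx)//; last 2 first.
- exact: measurable_avoid.
- exact: (measurable_state_action _ mf').
by congr (integral _ _ _); apply/seteqP; split=> w [/= H w0]; split=> //; apply/nuE.
Qed.

End one_law.
End costs_and_green.

Section one_law_consequences.
Context (R : realType) (X : pcountType) d (A : measurableType d).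
Variables (M : mdp R X A) (sigma : X -> probability A R).
Hypothesis sM : stationary M sigma.
Context (x : X) (Q : probability (traj X A) R).
Hypothesis Qx : path_law M (markov_rule sigma) x Q.
Local Open Scope ereal_scope.
Local Notation p := (mean_trans M sigma).

Lemma law_fibres k (G : set (traj X A)) : measurable G ->
  Q G = \esum_(y in [set: X]) Q (G `&` [set w | (w k).1 = y]).
Proof.
move=> mG; have := @integral_fibres _ _ R _ Q (fun w => (w k).1)
  (fun y => measurable_state k [set y]) G (cst 1) mG (measurable_cst _) (fun=> lee01).
rewrite integral_cst// mul1e => ->; apply: eq_esum => y _.
rewrite integral_cst ?mul1e//; apply: measurableI => //.
exact: (measurable_state k [set y]).
Qed.

Lemma law_init (G : set (traj X A)) : measurable G ->
  Q G = Q (G `&` [set w | (w 0%N).1 = x]).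
Proof.
move=> mG; have := integral_init Qx mG (measurable_cst (1 : \bar R)) (fun=> lee01).
rewrite !integral_cst ?mul1e//; apply: measurableI => //.
exact: (measurable_state 0 [set x]).
Qed.

Lemma law_next k (G : set (nat -> X * A)) y' :
  measurable (G : set (history X A k.+1 k)) ->
  Q (G `&` [set w | (w k.+1).1 = y']) = \int[Q]_(w in G) p (w k).1 y'.
Proof.
move=> mG; have mGt := measurable_history_traj mG.
rewrite (law_fibres k); last first.
  by apply: measurableI => //; exact: (measurable_state k.+1 [set y']).
rewrite (@integral_fibres _ _ _ _ Q (fun w => (w k).1))//; last 3 first.
- by move=> y; exact: (measurable_state k [set y]).
- apply: measurable_funTS.
  by apply: (measurable_state_action (f := fun y _ => p y y')) => y; exact: measurable_cst.
- by move=> w; exact: mean_trans_ge0.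
apply: eq_esum => y _; rewrite (eq_integral (fun=> p y y')); last first.
  by move=> w; rewrite inE => -[_ <-].
rewrite integral_cst; last first.
  by apply: measurableI => //; exact: (measurable_state k [set y]).
by rewrite muleC -(law_trans sM Qx)// setIAC.
Qed.

Lemma law_step k y' : Q [set w | (w k.+1).1 = y'] =
  \esum_(y in [set: X]) (Q [set w | (w k).1 = y] * p y y').
Proof.
rewrite (law_fibres k); last exact: (measurable_state k.+1 [set y']).
apply: eq_esum => y _; have := law_trans sM Qx y y' (k := k) (G := setT) measurableT.
by rewrite !setTI setIC.
Qed.

(** Read off from the law of x_1 under [Q], instead of integrating [trans_sum1] over the actions. *)
Lemma mean_trans_sum1 : \esum_(y in [set: X]) p x y = 1.
Proof.
have := law_start Qx; rewrite (law_fibres 1); last exact: (measurable_state 0 [set x]).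
move=> <-; apply: eq_esum => y _.
have := law_trans sM Qx x y (k := 0) (G := setT) measurableT.
by rewrite !setTI (law_start Qx) mul1e.
Qed.

Lemma visited_ind (S : set X) : S x ->
  (forall y y', S y -> 0 < p y y' -> S y') ->
  forall k y, 0 < Q [set w | (w k).1 = y] -> S y.
Proof.
move=> Sx Sstep; elim=> [|k IH] y.
  have [<-//|xy] := pselect (x = y).
  rewrite law_init; last exact: (measurable_state 0 [set y]).
  rewrite (_ : _ `&` _ = set0) ?measure0 ?ltxx//.
  by apply/seteqP; split=> // w [/= -> /esym].
rewrite law_step => pos; apply: contrapT => nSy; move: pos.
rewrite esum1 ?ltxx// => z _; have [Qz|Qz] := boolP (0 < Q [set w | (w k).1 = z]).
  have [pzy|] := boolP (0 < p z y); first by case: nSy; exact: Sstep (IH _ Qz) pzy.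
  rewrite -leNgt => pzy; rewrite (_ : p z y = 0) ?mule0//.
  by apply/eqP; rewrite eq_le pzy mean_trans_ge0.
rewrite (_ : Q _ = 0) ?mul0e//.
by apply/eqP; rewrite eq_le measure_ge0 andbT leNgt.
Qed.

Lemma visited_step k y y' : 0 < Q [set w | (w k).1 = y] -> 0 < p y y' ->
  0 < Q [set w | (w k.+1).1 = y'].
Proof.
move=> Qy pyy'; rewrite law_step; apply: lt_le_trans (mule_gt0 Qy pyy') _.
apply: (esum_ge_term (a := fun y => Q [set w | (w k).1 = y] * p y y')) => // z _.
by rewrite mule_ge0// mean_trans_ge0.
Qed.

Lemma mean_return_time y :
  \int[Q]_w return_time y w = cost_until (fun _ _ => 1%R) Q (return_time y).
Proof. by rewrite /cost_until; apply: eq_integral => w _; rewrite first_time_series. Qed.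

Lemma total_cost_iter N :
  (forall k, (k < N)%N ->
     iter k (taboo p set0) (mean_cost_rate sigma (pos_part (cost M))) x < +oo) ->
  (forall k, (k < N)%N ->
     iter k (taboo p set0) (mean_cost_rate sigma (neg_part (cost M))) x < +oo) ->
  total_cost M Q N = \sum_(k < N)
    (iter k (taboo p set0) (mean_cost_rate sigma (pos_part (cost M))) x -
     iter k (taboo p set0) (mean_cost_rate sigma (neg_part (cost M))) x).
Proof.
move=> fp fn.
pose c k (w : traj X A) : \bar R := (cost M (w k).1 (w k).2)%:E.
have mc k : measurable_fun setT (c k).
  apply/measurable_EFinP; apply: measurable_state_action.
  exact: measurable_cost.
(* An empty taboo set imposes nothing, so [law_avoid0] gives plain expectations at time [k]. *)
have av k : avoid set0 0 k = [set: traj X A] by apply/seteqP; split => // w _ m _ [].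
have ip k : \int[Q]_w (c k)^\+ w =
    iter k (taboo p set0) (mean_cost_rate sigma (pos_part (cost M))) x.
  rewrite -(law_avoid0 sM Qx); first 1 last.
  - by move=> y; apply/measurable_EFinP/measurable_pos_part; exact: measurable_cost.
  - by move=> y a; rewrite lee_fin pos_part_ge0.
  by rewrite av; apply: eq_integral => w _; rewrite funeposE /pos_part EFin_max.
have in_ k : \int[Q]_w (c k)^\- w =
    iter k (taboo p set0) (mean_cost_rate sigma (neg_part (cost M))) x.
  rewrite -(law_avoid0 sM Qx); first 1 last.
  - by move=> y; apply/measurable_EFinP/measurable_neg_part; exact: measurable_cost.
  - by move=> y a; rewrite lee_fin neg_part_ge0.
  by rewrite av; apply: eq_integral => w _; rewrite funenegE /neg_part EFin_max.
have ci k : (k < N)%N -> Q.-integrable setT (c k).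
  move=> kN; apply/integrableP; split => //.
  under eq_integral do rewrite -/((abse \o c k) _) fune_abse/=.
  rewrite ge0_integralD//; last 2 first.
  - exact: measurable_funepos.
  - exact: measurable_funeneg.
  by rewrite ip in_ lte_add_pinfty ?fp ?fn.
rewrite /total_cost /running_cost.
under eq_integral do rewrite -sumEFin.
rewrite (integral_sum _ (f := fun k : 'I_N => c k))//; last by move=> k; exact: ci.
by apply: eq_bigr => k _; rewrite integralE ip in_.
Qed.

End one_law_consequences.

(** * Excursions outside Z *)

Section induced_quantities.
Context (R : realType) (X : pcountType) d (A : measurableType d).
Variables (M : mdp R X A) (sigma : X -> probability A R).
Hypothesis sM : stationary M sigma.
Variable Q : X -> probability (traj X A) R.
Hypothesis QM : path_laws M (markov_rule sigma) Q.
Context (n : nat) (z : 'I_n.+1 -> X) (i : 'I_n.+1).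
Local Open Scope ereal_scope.
Local Notation Z := (range z).
Local Notation p := (mean_trans M sigma).
Local Notation rate := (mean_cost_rate sigma).

(* The expected sum of [f] over the excursion from z_i outside Z, if the first
   step leaves Z. *)
Definition excursion (f : X -> \bar R) : \bar R := taboo p Z (green p Z f) (z i).

Let p0 := mean_trans_ge0 sM.

Lemma excursion_ge0 f : (forall x, 0 <= f x) -> 0 <= excursion f.
Proof. by move=> f0; apply: taboo_ge0 => //; exact: green_ge0. Qed.

Lemma exit_probE : exit_prob M z sigma i = taboo p Z (cst 1) (z i).
Proof. by apply: eq_esum => x _; rewrite mule1. Qed.

Lemma outer_costE (f : X -> A -> R) x : (forall x, measurable_fun setT (f x)) ->
  (forall x a, (0 <= f x a)%R) -> ~ Z x ->
  outer_cost M z sigma Q i f x = p (z i) x * green p Z (rate f) x.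
Proof.
move=> mf f0 Zx; rewrite /outer_cost (cost_until_green sM (QM x) (D := Z))//.
- by move=> k; exact: measurable_lt_entry_time.
- by move=> w k w0; apply: lt_entry_time_outside; rewrite w0.
Qed.

Lemma esum_outer_cost (f : X -> A -> R) : (forall x, measurable_fun setT (f x)) ->
  (forall x a, (0 <= f x a)%R) ->
  \esum_(x in ~` Z) outer_cost M z sigma Q i f x = excursion (rate f).
Proof. by move=> mf f0; apply: eq_esum => x Zx; rewrite outer_costE. Qed.

Lemma le_rate (f g : X -> A -> R) : (forall x, measurable_fun setT (f x)) ->
  (forall x, measurable_fun setT (g x)) -> (forall x a, (0 <= f x a <= g x a)%R) ->
  forall x, rate f x <= rate g x.
Proof.
move=> mf mg fg x; apply: ge0_le_integral => //.
- by move=> a _; rewrite lee_fin; have /andP[] := fg x a.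
- exact/measurable_EFinP.
- exact/measurable_EFinP.
- by move=> a _; rewrite lee_fin; have /andP[] := fg x a.
Qed.

Lemma signed_sum_outer_cost :
  excursion (rate (fun x a => `|cost M x a|%R)) < +oo ->
  signed_sum (~` Z) (outer_cost M z sigma Q i (cost M)) =
  excursion (rate (pos_part (cost M))) - excursion (rate (neg_part (cost M))).
Proof.
set c := fun x a => `|cost M x a|%R; set cp := pos_part _; set cn := neg_part _.
have mc x : measurable_fun setT (c x).
  by apply: measurableT_comp => //; exact: measurable_cost.
have mcp x : measurable_fun setT (cp x).
  by apply: measurable_pos_part; exact: measurable_cost.
have mcn x : measurable_fun setT (cn x).
  by apply: measurable_neg_part; exact: measurable_cost.
have cpc x a : (0 <= cp x a <= c x a)%R.
  by rewrite pos_part_ge0 ge_max ler_norm normr_ge0.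
have cnc x a : (0 <= cn x a <= c x a)%R.
  by rewrite neg_part_ge0 ge_max /c -normrN ler_norm normr_ge0.
have cp0 x a : (0 <= cp x a)%R by exact: pos_part_ge0.
have cn0 x a : (0 <= cn x a)%R by exact: neg_part_ge0.
have c0 x a : (0 <= c x a)%R by exact: normr_ge0.
move=> fin.
have gp x : green p Z (rate cp) x <= green p Z (rate c) x.
  by apply: le_green => // y; [exact: mean_cost_rate_ge0|exact: le_rate].
have gn x : green p Z (rate cn) x <= green p Z (rate c) x.
  by apply: le_green => // y; [exact: mean_cost_rate_ge0|exact: le_rate].
have g0 (f : X -> A -> R) x : (forall x a, (0 <= f x a)%R) -> 0 <= green p Z (rate f) x.
  by move=> f0; apply: green_ge0 => // y; exact: mean_cost_rate_ge0.
pose a (f : X -> A -> R) x := p (z i) x * green p Z (rate f) x.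
have a0 (f : X -> A -> R) x : (forall x a, (0 <= f x a)%R) -> 0 <= a f x.
  by move=> f0; rewrite mule_ge0// g0.
have afin x : ~ Z x -> a c x < +oo.
  move=> Zx; apply: le_lt_trans fin.
  by apply: (esum_ge_term (a := a c)) => // y _; exact: a0.
have oE x : ~ Z x -> outer_cost M z sigma Q i (cost M) x = (a cp \- a cn) x.
  move=> Zx; rewrite /outer_cost /a/=.
  (* The cost until entry from [x] is known to be finite only when [x] is reached with positive
     probability; otherwise the factor 0 hides it. *)
  have [->|px0] := eqVneq (p (z i) x) 0; first by rewrite !mul0e sube0.
  have px : 0 < p (z i) x by rewrite lt_neqAle eq_sym px0 p0.
  have gfin : green p Z (rate c) x < +oo.
    have := afin _ Zx; rewrite /a !ltey; apply: contraNneq => ->.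
    by rewrite gt0_muley.
  have nuE (f : X -> A -> R) : (forall x, measurable_fun setT (f x)) ->
      (forall x a, (0 <= f x a)%R) ->
      cost_until f (Q x) (entry_time Z) = green p Z (rate f) x.
    move=> mf f0; apply: (cost_until_green sM (QM x) (D := Z)) => //.
    - by move=> k; exact: measurable_lt_entry_time.
    - by move=> w k w0; apply: lt_entry_time_outside; rewrite w0.
  rewrite cost_until_signed; last 3 first.
  - by move=> k; exact: measurable_lt_entry_time.
  - by move=> y; exact: measurable_cost.
  - by rewrite nuE.
  have pfin : p (z i) x \is a fin_num.
    rewrite ge0_fin_numE//; apply: (@le_lt_trans _ _ 1); last exact: ltry.
    rewrite -(mean_trans_sum1 sM (QM (z i))).
    by apply: esum_ge_term => // y _; exact: p0.
  rewrite !nuE// muleBr//; apply: fin_num_adde_defr.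
  by rewrite ge0_fin_numE ?g0// (le_lt_trans (gp x)).
(* The positive part of [a cp \- a cn] is in general smaller than [a cp]; only the differences of
   the sums agree, by summability. *)
rewrite /signed_sum -[RHS]esumB//.
- congr (_ - _); apply: eq_esum => x Zx.
  + by rewrite !funeposE oE.
  + by rewrite !funenegE oE.
- rewrite /summable (eq_esum (b := a cp)); last by move=> x _; rewrite gee0_abs ?a0.
  apply: le_lt_trans fin; apply: le_esum => x _; exact: lee_wpmul2l.
- rewrite /summable (eq_esum (b := a cn)); last by move=> x _; rewrite gee0_abs ?a0.
  apply: le_lt_trans fin; apply: le_esum => x _; exact: lee_wpmul2l.
- by move=> x _; exact: a0.
- by move=> x _; exact: a0.
Qed.

End induced_quantities.

(** * Mean duration and entry distribution of an excursion *)

Section entry.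
Context (R : realType) (X : pcountType) d (A : measurableType d).
Variables (M : mdp R X A) (sigma : X -> probability A R).
Hypothesis sM : stationary M sigma.
Variable Q : X -> probability (traj X A) R.
Hypothesis QM : path_laws M (markov_rule sigma) Q.
Context (n : nat) (z : 'I_n.+1 -> X) (i : 'I_n.+1).
Local Open Scope ereal_scope.
Local Notation Z := (range z).
Local Notation p := (mean_trans M sigma).
Local Notation rate := (mean_cost_rate sigma).
Local Notation exc := (excursion M sigma z i).
Local Notation e := (exit_prob M z sigma i).
Let p0 := mean_trans_ge0 sM.

Lemma exit_prob_fin_num : e \is a fin_num.
Proof.
rewrite ge0_fin_numE; last by apply: esum_ge0 => y _; exact: p0.
apply: (@le_lt_trans _ _ 1); last exact: ltry.
rewrite -(mean_trans_sum1 sM (QM (z i))) (esumID (~` Z)); last by move=> y _; exact: p0.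
by rewrite setTI leeDl// esum_ge0// => y _; exact: p0.
Qed.

Lemma law_avoid_set k x : Q x (avoid Z 0 k) = iter k (taboo p Z) (cst 1) x.
Proof.
rewrite -[cst 1](mean_cst sigma)// -(law_avoid0 sM (QM x))//.
by rewrite integral_cst ?mul1e//; exact: measurable_avoid.
Qed.

(** The entry time is summed over its tails: on paths that leave [Z] at time 1, it exceeds [k]
    exactly when the path stays outside [Z] from time 1 to [k]. *)
Lemma mean_entry_timeE : 0 < e ->
  mean_entry_time z Q i = 1 + exc (cst 1) * ((fine e)^-1)%:E.
Proof.
move=> e0; set E1 := [set w : traj X A | exit_time Z w = 1 :> \bar R].
have E1E w : E1 w <-> ~ Z (w 1%N).1 /\ Z (w 0%N).1.
  rewrite -[E1 w]/(exit_time Z w = 1%:R%:E :> \bar R) exit_time_eq.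
  by split=> [[Z1 /(_ 0%N (ltn0Sn 0))]//|[Z1 Z0]]; split=> // -[|].
have mE1 : measurable E1.
  rewrite (_ : E1 = [set w : traj X A | ~ Z (w 1%N).1] `&` [set w | Z (w 0%N).1]).
    by apply: measurableI; [exact: (measurable_state 1 (~` Z))|exact: (measurable_state 0 Z)].
  by apply/seteqP; split=> w /E1E.
pose S k := [set w : traj X A | k%:R%:E < entry_time Z w :> \bar R].
have mS k : measurable (S k) by exact: measurable_lt_entry_time.
have tauE w : entry_time Z w = \sum_(0 <= k <oo) (cst 1 \_ (S k)) w :> \bar R.
  rewrite /entry_time -first_time_series eseries_mkcond; apply: eq_eseriesr => k _.
  by rewrite /patch; case: ifPn => [kt|/negP kt]; [rewrite mem_set|rewrite memNset].
have mS1 k D : measurable_fun D (cst (1 : \bar R) \_ (S k)).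
  by apply: measurable_funTS; apply/(measurable_restrictT _ (mS k)).
have S0 k w : 0 <= (cst (1 : \bar R) \_ (S k)) w.
  by rewrite /patch; case: ifP.
(* The values [k = 0] and [k = 1] both give the exit probability; after division by [e] the extra
   copy is the leading 1 of the formula. *)
have QE k : Q (z i) (E1 `&` S k) = iter (maxn k 1) (taboo p Z) (cst 1) (z i).
  rewrite -law_avoid_set (law_init (QM (z i))); last exact: measurableI.
  rewrite [RHS](law_init (QM (z i))); last exact: measurable_avoid.
  congr (Q (z i) _); apply/seteqP; split=> w /=.
    move=> [[/E1E[Z1 Z0] /lt_entry_time H] w0]; split => // m; rewrite add0n.
    case: m => // -[//|m] /andP[_]; rewrite leq_max orbF => mk.
    apply: (H 1%N (leq_trans _ mk) Z1) => //.
    by rewrite subnKC//; exact: leq_trans mk.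
  move=> [H w0]; have Z1 : ~ Z (w 1%N).1 by apply: H; rewrite add0n leq_max orbT.
  have Z0 : Z (w 0%N).1 by rewrite w0; exists i.
  split => //; split; first exact/E1E.
  apply/lt_entry_time => j jk Zj m /andP[jm].
  rewrite subnKC// => mk; apply: H; rewrite add0n leq_max mk andbT.
  exact: leq_ltn_trans jm.
rewrite /mean_entry_time /cond_mean -/E1.
under eq_integral do rewrite tauE.
rewrite integral_nneseries//.
have -> : \sum_(0 <= k <oo) \int[Q (z i)]_(w in E1) (cst 1 \_ (S k)) w =
    \sum_(0 <= k <oo) iter (maxn k 1) (taboo p Z) (cst 1) (z i).
  apply: eq_eseriesr => k _; rewrite -integral_mkcondr integral_cst ?mul1e;
    [exact: QE|exact: measurableI].
have it0 k : 0 <= iter k (taboo p Z) (cst 1) (z i) by exact: iter_taboo_ge0.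
rewrite nneseries_recl// max0n [iter 1 _ _ _]/= -exit_probE.
have -> : \sum_(1 <= k <oo) iter (maxn k 1) (taboo p Z) (cst 1) (z i) = exc (cst 1).
  rewrite -[RHS]/(iter 1 (taboo p Z) (green p Z (cst 1)) (z i)) taboo_green//.
  rewrite -nneseries_addn// -[RHS]nneseries_addn//.
  by apply: eq_eseriesr => k _; rewrite addn1 (maxn_idPl _).
have -> : Q (z i) E1 = e.
  rewrite exit_probE -[RHS](QE 0%N).
  congr (Q (z i) _); apply/seteqP; split=> [w E1w|w []//]; split=> //.
  apply/lt_entry_time => j; rewrite leqn0 => /eqP ->.
  by have /E1E[] := E1w.
have ef := exit_prob_fin_num.
have fe0 : fine e != 0%R by rewrite gt_eqF// fine_gt0// e0 ltey_eq ef.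
rewrite ge0_muleDl//; last by apply: excursion_ge0.
  by congr (_ + _); rewrite -{1}(fineK ef) -EFinM divff.
exact: ltW.
Qed.

(** The conditioning event allows the path to move inside [Z] and come back to z_i before leaving.
    By the Markov property, the part where [Z] is left at time [k + 1] contributes the same factor
    to numerator and denominator, so their common sum [s] over [k] cancels. *)
Lemma entry_probE l : 0 < e ->
  entry_prob z Q i l = (fine (exc (p ^~ (z l))) / fine e)%R.
Proof.
move=> e0; pose G k := [set w : nat -> X * A | forall m, (m <= k)%N -> Z (w m).1].
pose at_zi k := [set w : nat -> X * A | (w k).1 = z i].
have mG k : measurable (G k : set (history X A k.+1 k)).
  rewrite (_ : G k = \bigcap_m [set w | (m <= k)%N -> Z (w m).1]); last first.
    by apply/seteqP; split=> [w H m _|w H m]; apply: H.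
  apply: bigcapT_measurable => m; have [mk|mk] := leqP m k.
    rewrite (_ : mkset _ = [set w | Z (w m).1]); last first.
      by apply/seteqP; split=> w /= ; [apply|].
    exact: measurable_history_state.
  by rewrite (_ : mkset _ = setT)//; apply/seteqP; split.
have mGz k : measurable (G k `&` at_zi k : set (history X A k.+1 k)).
  by apply: measurableI => //; exact: (measurable_history_state [set z i]).
(* [L k]: Z is left at time k + 1, from z_i. *)
pose L k := G k `&` at_zi k `&` avoid Z k 1.
have exitL k w : L k w -> exit_time Z w = k.+1%:R%:E :> \bar R.
  move=> [[Gw _] H]; apply/exit_time_eq; split; last exact: Gw.
  by apply: (H k.+1); rewrite addn1 !leqnn.
have LE : leave_from R z i = \bigcup_k L k :> set (traj X A).
  apply/seteqP; split=> [w [k [/exit_time_eq[Zk H] wk]]|w [k _ Lw]]; last first.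
    by exists k; split; [exact: exitL|case: Lw => -[]].
  exists k => //; split; first by split => // m mk; apply: H.
  by move=> m; rewrite addn1 andbC -eqn_leq => /eqP ->.
have mL k : measurable (L k : set (traj X A)).
  by apply: measurableI; [exact: measurable_history_traj (mGz k)|exact: measurable_avoid].
have tL : trivIset setT (L : nat -> set (traj X A)).
  move=> k k' _ _ [w [/exitL + /exitL]] => -> [].
  by move/eqP; rewrite eqr_nat => /eqP[].
(* [N l k r]: moreover Z is entered after r + 1 steps outside, at z_l. *)
pose N l k r := G k `&` at_zi k `&` avoid Z k r.+1 `&`
  [set w | (w (k + r.+1).+1).1 = z l].
have NE k : L k `&` enter_at R z l = \bigcup_r N l k r :> set (traj X A).
  apply/seteqP; split=> [w [Lw [K [/(entry_time_eq _ (exitL k w Lw)) [kK ZK H] wK]]]|].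
    exists (K - k.+2)%N => //; have KE : (k + (K - k.+2).+1).+1 = K.
      by rewrite addnS -!addSn subnKC.
    split; last by rewrite /= KE.
    split; first by case: Lw.
    rewrite avoidS; split.
      by case: Lw => _ /(_ k.+1); apply; rewrite addn1 !leqnn.
    by move: H; rewrite -subn1 -subnDA add1n.
  move=> w [r _ [[[Gw wk] H] wr]].
  have Lw : L k w.
    split => // m; rewrite addn1 => /andP[km mk]; apply: H.
    by rewrite km (leq_trans mk)// addnS ltnS leq_addr.
  split=> //; exists (k + r.+1).+1; split=> //.
  apply/(entry_time_eq _ (exitL k w Lw)); split.
  - by rewrite ltnS addnS ltnS leq_addr.
  - by rewrite wr; exists l.
  - by move: H; rewrite avoidS => -[_]; rewrite /= addnS subSS addKn.
have mN k r : measurable (N l k r : set (traj X A)).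
  apply: measurableI; last exact: (measurable_state _ [set z l]).
  by apply: measurableI; [exact: measurable_history_traj (mGz k)|exact: measurable_avoid].
have tN k : trivIset setT (N l k : nat -> set (traj X A)).
  move=> r r' _ _ [w [[[_ H] wr] [[_ H'] wr']]].
  have lt a b : avoid Z k b.+1 w -> (w (k + a.+1).+1).1 = z l -> (b <= a)%N.
    move=> Hb wa; rewrite leqNgt; apply/negP => ab.
    apply: (Hb (k + a.+1).+1); last by rewrite wa; exists l.
    by rewrite ltnS leq_addr/= -addnS leq_add2l.
  by apply/eqP; rewrite eqn_leq (lt _ _ H' wr) (lt _ _ H wr').
have sM1 (y : X) : measurable_fun setT (fun a : A => 1 : \bar R) by exact: measurable_cst.
have QL k : Q (z i) (L k) = Q (z i) (G k `&` at_zi k) * e.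
  have := law_avoid sM (QM (z i)) Z 1 (z i) (f := fun _ _ => 1) sM1 (fun _ _ => lee01) (mG k).
  rewrite integral_cst; last exact: mL.
  by rewrite mul1e exit_probE /= mean_cst.
have QN k r : Q (z i) (N l k r) =
    Q (z i) (G k `&` at_zi k) * iter r.+1 (taboo p Z) (p ^~ (z l)) (z i).
  have mav : measurable (G k `&` at_zi k `&` avoid Z k r.+1 :
      set (history X A (k + r.+1).+1 (k + r.+1))).
    apply: measurableI; last exact: measurable_history_avoid.
    by apply: measurable_historyW (mGz k); rewrite ?ltnS leq_addr.
  rewrite (law_next sM (QM (z i)) (z l) mav).
  have := law_avoid sM (QM (z i)) Z r.+1 (z i) (f := fun y _ => p y (z l)) _ _ (mG k).
  by rewrite mean_cst//; apply.
have p0l y : 0 <= p y (z l) by exact: p0.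
have QLN k : Q (z i) (L k `&` enter_at R z l) =
    Q (z i) (G k `&` at_zi k) * exc (p ^~ (z l)).
  have fQ : Q (z i) (G k `&` at_zi k) \is a fin_num.
    by apply: fin_num_measure; exact: measurable_history_traj (mGz k).
  rewrite NE measure_bigcup//.
  rewrite (eq_eseriesl (Q := xpredT)); last by move=> r; rewrite mem_set.
  rewrite (eq_eseriesr (fun r _ => QN k r)) -{1}(fineK fQ).
  rewrite nneseriesZl; last by move=> r _; exact: iter_taboo_ge0.
  rewrite fineK//; congr (_ * _).
  rewrite -[RHS]/(iter 1 (taboo p Z) (green p Z _) (z i)) taboo_green//.
  rewrite -[RHS]nneseries_addn; last by move=> r; exact: iter_taboo_ge0.
  by apply: eq_eseriesr => r _; rewrite addn1.
(* The expected number of times at z_i before [Z] is left. It is at least 1 by its term [k = 0], and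
   finite because [s * e] is a probability and [e] is positive. *)
pose s := \sum_(0 <= k <oo) Q (z i) (G k `&` at_zi k).
have s0 k : 0 <= Q (z i) (G k `&` at_zi k) by exact: measure_ge0.
have QLs : Q (z i) (leave_from R z i) = s * e.
  rewrite LE measure_bigcup// (eq_eseriesl (Q := xpredT)); last by move=> r; rewrite mem_set.
  rewrite (eq_eseriesr (fun k _ => QL k)).
  under eq_eseriesr do rewrite muleC -(fineK exit_prob_fin_num).
  by rewrite nneseriesZl// fineK ?exit_prob_fin_num// muleC.
have b0 : 0 <= exc (p ^~ (z l)) by exact: excursion_ge0.
have bfin : exc (p ^~ (z l)) \is a fin_num.
  rewrite ge0_fin_numE//; apply: (@le_lt_trans _ _ 1); last exact: ltry.
  apply: (@le_trans _ _ (Q (z i) (L 0%N `&` enter_at R z l))).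
    rewrite QLN (_ : Q (z i) _ = 1) ?mul1e//.
    rewrite -(law_start (QM (z i))); congr (Q (z i) _); apply/seteqP; split=> [w []//|w w0].
    by split=> // m; rewrite leqn0 => /eqP ->; rewrite w0; exists i.
  by apply: probability_le1; rewrite NE; exact: bigcupT_measurable.
have QEs : Q (z i) (enter_at R z l `&` leave_from R z i) = s * exc (p ^~ (z l)).
  rewrite LE setI_bigcupr (eq_bigcupr (fun k _ => setIC (enter_at R z l) (L k))).
  rewrite measure_bigcup//; first last.
  - move=> k k' _ _ [w [[Lw _] [Lw' _]]]; apply: tL => //; by exists w.
  - by move=> k _; rewrite NE; exact: bigcupT_measurable.
  rewrite (eq_eseriesl (Q := xpredT)); last by move=> r; rewrite mem_set.
  rewrite (eq_eseriesr (fun k _ => QLN k)).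
  under eq_eseriesr do rewrite muleC -(fineK bfin).
  by rewrite nneseriesZl// fineK// muleC.
have s1 : 1 <= s.
  rewrite /s nneseries_recl// (_ : Q (z i) _ = 1); last first.
    rewrite -(law_start (QM (z i))); congr (Q (z i) _); apply/seteqP; split=> [w []//|w w0].
    by split=> // m; rewrite leqn0 => /eqP ->; rewrite w0; exists i.
  by rewrite leeDl//; exact: nneseries_ge0.
have fe0 : (0 < fine e)%R by rewrite fine_gt0// e0 ltey_eq exit_prob_fin_num.
have sfin : s \is a fin_num.
  rewrite ge0_fin_numE; last exact: le_trans s1.
  have : s * e <= 1.
    by rewrite -QLs; apply: probability_le1; rewrite LE; exact: bigcupT_measurable.
  by rewrite ltey; apply: contraTneq => ->; rewrite gt0_mulye.
rewrite /entry_prob /cond_prob QEs QLs !fineM ?exit_prob_fin_num//.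
rewrite -mulf_div divff ?mul1r// gt_eqF// -lte_fin fineK//.
exact: lt_le_trans s1.
Qed.

End entry.

(** * The two average costs *)

Section embedded_chain.
Context (R : realType) (X : pcountType) d (A : measurableType d).
Variables (M : mdp R X A) (sigma : X -> probability A R).
Hypothesis sM : stationary M sigma.
Variable Q : X -> probability (traj X A) R.
Hypothesis QM : path_laws M (markov_rule sigma) Q.
Context (n : nat) (z : 'I_n.+1 -> X).
Hypothesis z_inj : injective z.
Variable i : 'I_n.+1.
Hypothesis zi_recurrent : recurrent Q (z i).
Local Open Scope ereal_scope.
Hypothesis cost_fin :
  cost_until (fun x a => `|cost M x a|%R) (Q (z i)) (return_time (z i)) < +oo.
Local Notation Z := (range z).
Local Notation p := (mean_trans M sigma).
Local Notation rate := (mean_cost_rate sigma).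
Local Notation H f := (green p [set z i] f).
Local Notation exc j f := (excursion M sigma z j f).
Local Notation cabs := (fun x a => `|cost M x a|%R).
Local Notation cp := (pos_part (cost M)).
Local Notation cn := (neg_part (cost M)).
Local Notation exitp j := (exit_prob M z sigma j).

Let p0 := mean_trans_ge0 sM.
Let p1 x := mean_trans_sum1 sM (QM x).

Let rate_abs_ge0 x : 0 <= rate cabs x.
Proof. by apply: mean_cost_rate_ge0 => y a; exact: normr_ge0. Qed.
Let rate_cp_ge0 x : 0 <= rate cp x.
Proof. by apply: mean_cost_rate_ge0 => y a; exact: pos_part_ge0. Qed.
Let rate_cn_ge0 x : 0 <= rate cn x.
Proof. by apply: mean_cost_rate_ge0 => y a; exact: neg_part_ge0. Qed.

Let m_cabs x : measurable_fun setT (cabs x).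
Proof. by apply: measurableT_comp => //; exact: measurable_cost. Qed.
Let m_cp x : measurable_fun setT (cp x).
Proof. by apply: measurable_pos_part; exact: measurable_cost. Qed.
Let m_cn x : measurable_fun setT (cn x).
Proof. by apply: measurable_neg_part; exact: measurable_cost. Qed.

Lemma le_cp_cabs x : rate cp x <= rate cabs x.
Proof.
apply: le_rate => // y a.
by rewrite pos_part_ge0 ge_max ler_norm normr_ge0.
Qed.

Lemma le_cn_cabs x : rate cn x <= rate cabs x.
Proof.
apply: le_rate => // y a.
by rewrite neg_part_ge0 ge_max -normrN ler_norm normr_ge0.
Qed.

Definition visited : set X := [set y | accessible Q (z i) y].

Lemma visited_closed y y' : visited y -> 0 < p y y' -> visited y'.
Proof. by move=> [k Qk] pyy'; exists k.+1; exact: (visited_step sM (QM (z i))) Qk pyy'. Qed.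

Lemma visited_zi : visited (z i).
Proof. by exists 0%N; rewrite (law_start (QM (z i))). Qed.

(** By [green_lty_step] finiteness passes along every transition that does not hit z_i, and at z_i
    it is the hypothesis. *)
Lemma green_visited f : (forall x, 0 <= f x) -> H f (z i) < +oo ->
  forall y, visited y -> H f y < +oo.
Proof.
move=> f0 fin y [k]; apply: (visited_ind sM (QM (z i)) (S := [set y | H f y < +oo])) => //.
move=> x x' Hx pxx' /=; have [->//|xz] := pselect (x' = z i).
exact: (green_lty_step p0 f0 (Hx : H f x < +oo) pxx' xz).
Qed.

Let return_green (f : X -> A -> R) : (forall x, measurable_fun setT (f x)) ->
  (forall x a, (0 <= f x a)%R) ->
  cost_until f (Q (z i)) (return_time (z i)) = H (rate f) (z i).
Proof.
move=> mf f0; apply: (cost_until_green sM (QM (z i))) => //.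
- by move=> k; exact: measurable_lt_return_time.
- by move=> w k _; exact: lt_return_time.
Qed.

Lemma green1_lty y : visited y -> H (cst 1) y < +oo.
Proof.
apply: green_visited => //; have [_] := zi_recurrent.
rewrite mean_return_time return_green//.
by rewrite (_ : rate _ = cst 1)//; exact: mean_cst.
Qed.

Lemma green_abs_lty y : visited y -> H (rate cabs) y < +oo.
Proof. by apply: green_visited => //; rewrite -return_green. Qed.

Lemma green_cp_lty y : visited y -> H (rate cp) y < +oo.
Proof.
move=> vy; apply: le_lt_trans (green_abs_lty vy).
by apply: le_green => //; exact: le_cp_cabs.
Qed.

Lemma green_cn_lty y : visited y -> H (rate cn) y < +oo.
Proof.
move=> vy; apply: le_lt_trans (green_abs_lty vy).
by apply: le_green => //; exact: le_cn_cabs.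
Qed.

Definition cycle_average : R :=
  ((fine (H (rate cp) (z i)) - fine (H (rate cn) (z i))) / fine (H (cst 1%E) (z i)))%R.

Lemma mean_cost_cvg : mean_cost M (Q (z i)) N @[N --> \oo] --> cycle_average%:E.
Proof.
have [fp cvp] := cesaro_iter_step p0 p1 rate_cp_ge0 (green1_lty visited_zi)
  (green_cp_lty visited_zi).
have [fn cvn] := cesaro_iter_step p0 p1 rate_cn_ge0 (green1_lty visited_zi)
  (green_cn_lty visited_zi).
have ip0 k : 0 <= iter k (taboo p set0) (rate cp) (z i) by exact: iter_taboo_ge0.
have in0 k : 0 <= iter k (taboo p set0) (rate cn) (z i) by exact: iter_taboo_ge0.
rewrite (_ : mean_cost M (Q (z i)) = (fun N =>
   (N%:R^-1 * \sum_(k < N) fine (iter k (taboo p set0) (rate cp) (z i)) -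
    N%:R^-1 * \sum_(k < N) fine (iter k (taboo p set0) (rate cn) (z i)))%R%:E)).
  apply: cvg_EFin; first exact: nearW.
  by rewrite /cycle_average mulrBl; exact: cvgB cvp cvn.
apply/funext => N; rewrite /mean_cost (total_cost_iter sM (QM (z i)))// -mulrBr EFinM.
congr (_ * _); rewrite -sumrB -sumEFin; apply: eq_bigr => k _.
by rewrite EFinB !fineK// ge0_fin_numE.
Qed.


Local Notation after := (green_after p z i).

Let one_ge0 (x : X) : 0 <= (cst 1 x : \bar R). Proof. by []. Qed.

Lemma exit_prob_ge0 j : 0 <= exitp j.
Proof. by apply: esum_ge0 => y _; exact: p0. Qed.

Lemma sum_exc_entry j : visited (z j) -> \sum_l exc j (p ^~ (z l)) = exitp j.
Proof.
move=> vj; rewrite exit_probE -(excursion_total p0 p1 z_inj)//.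
apply: le_lt_trans (green1_lty vj).
by apply: le_green => // _ ->; exists i.
Qed.

Lemma exc_entry_fin_num j l : visited (z j) -> exc j (p ^~ (z l)) \is a fin_num.
Proof.
move=> vj; rewrite ge0_fin_numE ?excursion_ge0//.
apply: (@le_lt_trans _ _ (exitp j)); last first.
  by rewrite ltey_eq (exit_prob_fin_num sM QM).
rewrite -sum_exc_entry// (bigD1 l)//= leeDl// sume_ge0// => k _.
exact: excursion_ge0.
Qed.

Lemma mean_trans_fin_num x y : p x y \is a fin_num.
Proof.
rewrite ge0_fin_numE//; apply: (@le_lt_trans _ _ 1); last exact: ltry.
by rewrite -(p1 x); exact: esum_ge_term.
Qed.

(** At a [z l] that is not reached, [after f l] may be infinite. Since the whole sum is finite its
    coefficients are then 0, and [fineM_lty] still gives an identity between real numbers. *)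
Lemma green_through_fine f j : (forall x, 0 <= f x) -> visited (z j) ->
  H f (z j) < +oo ->
  [/\ f (z j) < +oo, exc j f < +oo &
  (fine (H f (z j)) = fine (f (z j)) +
    \sum_l fine (p (z j) (z l)) * fine (after f l) +
    (fine (exc j f) + \sum_l fine (exc j (p ^~ (z l))) * fine (after f l)))%R].
Proof.
move=> f0 vj fin; have gE : H f (z j) = f (z j) + \sum_l p (z j) (z l) * after f l +
    (exc j f + \sum_l exc j (p ^~ (z l)) * after f l).
  exact: (green_through p0 z_inj f0 fin).
have a0 l : 0 <= after f l by exact: green_after_ge0.
have e0 l : 0 <= exc j (p ^~ (z l)) by apply: excursion_ge0.
have exf0 : 0 <= exc j f by exact: excursion_ge0.
have A0 : 0 <= \sum_l p (z j) (z l) * after f l.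
  by apply: sume_ge0 => l _; rewrite mule_ge0.
have B0 : 0 <= \sum_l exc j (p ^~ (z l)) * after f l.
  by apply: sume_ge0 => l _; rewrite mule_ge0.
move: (fin); rewrite gE => /ge0_addends_lty[||]; [by rewrite adde_ge0|by rewrite adde_ge0|].
move=> /ge0_addends_lty[//|//|fjf Af] /ge0_addends_lty[//|//|ejf Bf]; split=> //.
have sum_lty (a b : 'I_n.+1 -> \bar R) : (forall l, 0 <= a l) -> (forall l, 0 <= b l) ->
    (forall l, a l \is a fin_num) -> \sum_l a l * b l < +oo ->
    \sum_l a l * b l = (\sum_l fine (a l) * fine (b l))%R%:E.
  move=> a0' b0 af ab; rewrite -sumEFin; apply: eq_bigr => l _; apply: fineM_lty => //.
  apply: le_lt_trans ab; rewrite (bigD1 l)//= leeDl// sume_ge0// => k _.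
  by rewrite mule_ge0.
apply: EFin_inj; rewrite fineK; last by rewrite -gE ge0_fin_numE// gE !adde_ge0.
rewrite !EFinD /= !fineK ?ge0_fin_numE//.
rewrite -(sum_lty (fun l => p (z j) (z l)) (after f))//; last first.
  by move=> l; exact: mean_trans_fin_num.
rewrite -(sum_lty (fun l => exc j (p ^~ (z l))) (after f))//.
by move=> l; exact: exc_entry_fin_num.
Qed.

(** Solution of the equation for [lam] in [induced_action]: by [mean_entry_timeE], its inverse is
    the mean time spent outside [Z] given that the step from [z j] leaves [Z]. The quotients by
    [exitp j] below are likewise conditional, and [outside_cost] is a cost per unit of time. *)
Definition hold_rate j : R := (fine (exitp j) / fine (exc j (cst 1%E)))%R.
Definition entry_law j l : R := (fine (exc j (p ^~ (z l))) / fine (exitp j))%R.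
Definition outside_cost j : R :=
  ((fine (exc j (rate cp)) - fine (exc j (rate cn))) / fine (exitp j) * hold_rate j)%R.
Definition outside_action j : n.+1.-tuple R * R :=
  ([tuple (hold_rate j * entry_law j l)%R | l < n.+1], outside_cost j).

Section visited_exit.
Variable j : 'I_n.+1.
Hypotheses (vj : visited (z j)) (ej : 0 < exitp j).

Let e0 : (0 < fine (exitp j))%R.
Proof. by rewrite fine_gt0// ej ltey_eq (exit_prob_fin_num sM QM). Qed.

Let exc1_fin : exc j (cst 1) \is a fin_num.
Proof.
rewrite ge0_fin_numE ?excursion_ge0//.
by have [] := green_through_fine one_ge0 vj (green1_lty vj).
Qed.

(** An excursion lasts at least one step; this is what makes [hold_rate j] at most 1. *)
Let e_le_exc1 : (fine (exitp j) <= fine (exc j (cst 1%E)))%R.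
Proof.
apply: fine_le => //; first by rewrite (exit_prob_fin_num sM QM).
rewrite exit_probE /excursion; apply: le_taboo => //; first by move=> x; exact: green_ge0.
by move=> x; rewrite green_rec// leeDl//; apply: taboo_ge0 => // y; exact: green_ge0.
Qed.

Let exc1_gt0 : (0 < fine (exc j (cst 1%E)))%R.
Proof. exact: lt_le_trans e_le_exc1. Qed.

Lemma hold_rate_gt0 : (0 < hold_rate j)%R.
Proof. exact: divr_gt0. Qed.

Lemma entry_law_ge0 l : (0 <= entry_law j l)%R.
Proof. by rewrite divr_ge0 ?fine_ge0 ?excursion_ge0 ?exit_prob_ge0. Qed.

Lemma entry_law_sum1 : (\sum_l entry_law j l = 1)%R.
Proof.
rewrite -mulr_suml sum_fine; last by move=> l _; exact: exc_entry_fin_num.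
by rewrite sum_exc_entry// divff// gt_eqF.
Qed.

(** This is what pins down sigma_0: [associated] prescribes the action at a visited omega_j only if
    some action is induced there. All the required finiteness comes from the cycle sums through
    [green_through_fine]. *)
Lemma outside_action_induced : induced_action M z sigma Q j (outside_action j).
Proof.
exists (hold_rate j), (entry_law j), (outside_cost j); split=> //.
  split=> //; last exact: entry_law_sum1.
    by rewrite hold_rate_gt0/= ler_pdivrMr// mul1r.
  exact: entry_law_ge0.
split.
- by move=> l; rewrite (entry_probE sM QM).
- by rewrite (mean_entry_timeE sM QM)// /hold_rate invf_div EFinM fineK.
- rewrite (esum_outer_cost sM QM); [|exact: m_cabs|by move=> x a; exact: normr_ge0].
  by case: (green_through_fine rate_abs_ge0 vj (green_abs_lty vj)).
rewrite (signed_sum_outer_cost sM QM); last first.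
  by case: (green_through_fine rate_abs_ge0 vj (green_abs_lty vj)).
have fp : exc j (rate cp) \is a fin_num.
  rewrite ge0_fin_numE; last exact: excursion_ge0.
  by case: (green_through_fine rate_cp_ge0 vj (green_cp_lty vj)).
have fn : exc j (rate cn) \is a fin_num.
  rewrite ge0_fin_numE; last exact: excursion_ge0.
  by case: (green_through_fine rate_cn_ge0 vj (green_cn_lty vj)).
rewrite -(fineK fp) -(fineK fn) -EFinB -!EFinM invrK /outside_cost; congr EFin.
by rewrite [in RHS](mulrC (fine _)^-1%R).
Qed.

End visited_exit.

End embedded_chain.

(** * Algebra of the Poisson equation *)

Section poisson_identities.
Context (R : realType).
Implicit Types a b c g e k t u v w : R.

Lemma sum_rel_term w a b g c :
  w * (a - b - g * c) = w * a - w * b - g * (w * c).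
Proof. by ring. Qed.

Lemma omega_term a b e c : a * (b / e) * c = a / e * (b * c).
Proof. by ring. Qed.

(** Plain, primed and [1] letters belong to the positive part, the negative part and the unit cost.
    They stand for the cost at the state ([c]), the sum over direct steps into Z ([u]), the
    excursion ([k]) and what follows it ([t]); [g] is the average. *)
Lemma poisson_s_identity c c' u u' u1 k k' k1 t t' t1 g :
  c - c' + (u - u' - g * u1 + (k - k' - g * k1 + (t - t' - g * t1))) =
  g + (c + u + (k + t) - (c' + u' + (k' + t')) - g * (1 + u1 + (k1 + t1))).
Proof. by ring. Qed.

Lemma poisson_omega_identity k k' k1 e t g : e != 0 -> k1 != 0 ->
  (k - k') / e * (e / k1) +
    (e / k1 / e * t + (1 - e / k1) * ((k - k' - g * k1 + t) / e)) =
  g + (k - k' - g * k1 + t) / e.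
Proof. by move=> e0 k0; field; rewrite e0 k0. Qed.

End poisson_identities.

(** * The embedded chain and its relative cost *)

Section embedded_policy.
Context (R : realType) (X : pcountType) d (A : measurableType d).
Variables (M : mdp R X A) (sigma : X -> probability A R).
Hypothesis sM : stationary M sigma.
Variable Q : X -> probability (traj X A) R.
Hypothesis QM : path_laws M (markov_rule sigma) Q.
Context (n : nat) (z : 'I_n.+1 -> X).
Hypothesis z_inj : injective z.
Variable i : 'I_n.+1.
Hypothesis zi_recurrent : recurrent Q (z i).
Local Open Scope ereal_scope.
Hypothesis cost_fin :
  cost_until (fun x a => `|cost M x a|%R) (Q (z i)) (return_time (z i)) < +oo.
Local Notation emb_action := (A + (n.+1.-tuple R * R))%type.
Variable sigma0 : emb_state n -> probability emb_action R.
Hypothesis sigma0_associated : associated M z_inj sigma Q sigma0.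
Variable Q0 : emb_state n -> probability (traj (emb_state n) emb_action) R.
Local Notation M0 := (embedded_mdp M z_inj).
Hypothesis Q0M : path_laws M0 (markov_rule sigma0) Q0.

Local Notation p := (mean_trans M sigma).
Local Notation q := (mean_trans M0 sigma0).
Local Notation exitp j := (exit_prob M z sigma j).
Local Notation exc j f := (excursion M sigma z j f).
Local Notation vis := (visited Q z i).
Local Notation lam j := (hold_rate M sigma z j).
Local Notation law j l := (entry_law M sigma z j l).
Local Notation oc j := (outside_cost M sigma z j).
Local Notation oa j := (outside_action M sigma z j).

Lemma sigma0_stationary : stationary M0 sigma0.
Proof. by case: sigma0_associated. Qed.

Lemma measurable_inl : measurable_fun setT (inl : A -> emb_action).
Proof. by move=> _ B [mB _]; rewrite setTI. Qed.

Lemma integral_s j (f : emb_action -> \bar R) : measurable_fun setT f ->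
  (forall a, 0 <= f a) ->
  \int[sigma0 (s_ j)]_a f a = \int[sigma (z j)]_a f (inl a).
Proof.
move=> mf f0; case: sigma0_associated => _ H _.
have := @ge0_integral_pushforward _ _ _ _ R _ measurable_inl (sigma (z j)) setT f
  measurableT mf (fun a _ => f0 a).
rewrite preimage_setT /comp => <-.
rewrite [RHS](eq_measure_integral (sigma0 (s_ j)))//; last first.
  by move=> mi B mB _; apply/esym; exact: H.
exact: measurable_inl.
Qed.

Lemma integral_omega j (f : emb_action -> \bar R) : vis (z j) -> 0 < exitp j ->
  measurable_fun setT f -> \int[sigma0 (omega_ j)]_a f a = f (inr (oa j)).
Proof.
move=> vj ej mf; case: sigma0_associated => _ _ H.
have {}H B : measurable B -> sigma0 (omega_ j) B = \d_(inr (oa j)) B.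
  apply: H; first by exists i.
  exact: (outside_action_induced sM QM z_inj zi_recurrent cost_fin vj ej).
rewrite (eq_measure_integral (\d_(inr (oa j) : emb_action))) => [|B mB _]; last exact: H.
by rewrite integral_dirac// diracT mul1e.
Qed.

Let m_emb_trans x y : measurable_fun setT (fun a => (trans M0 x a y)%:E).
Proof. by apply/measurable_EFinP; exact: (measurable_trans M0). Qed.

Lemma trans_ss j l : q (s_ j) (s_ l) = p (z j) (z l).
Proof.
rewrite (mean_transE sigma0_stationary) (mean_transE sM) integral_s//; last first.
  exact: measurable_funepos.
by apply: eq_integral => a _; rewrite !funeposE.
Qed.

Lemma trans_so j l : l != j -> q (s_ j) (omega_ l) = 0.
Proof.
move=> lj; rewrite (mean_transE sigma0_stationary) integral_s//; last first.
  exact: measurable_funepos.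
rewrite -[RHS](integral0 (sigma (z j)) setT); apply: eq_integral => a _.
by rewrite funeposE /= (negbTE lj) maxxx.
Qed.

Lemma trans_os j l : vis (z j) -> 0 < exitp j ->
  q (omega_ j) (s_ l) = (lam j * law j l)%:E.
Proof.
move=> vj ej; rewrite /mean_trans integral_omega//.
by congr EFin; exact: tnth_mktuple.
Qed.

Lemma trans_oo j l : vis (z j) -> 0 < exitp j ->
  q (omega_ j) (omega_ l) = (if l == j then 1 - lam j else 0)%:E.
Proof.
move=> vj ej; rewrite /mean_trans integral_omega//; congr EFin => /=.
case: ifP => // _; congr (_ - _)%R.
rewrite -[RHS]mulr1 -[in RHS](entry_law_sum1 sM QM z_inj zi_recurrent vj ej).
by rewrite mulr_sumr; apply: eq_bigr => k _; exact: tnth_mktuple.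
Qed.

Definition emb_states : seq (emb_state n) :=
  map (@s_ n) (index_enum 'I_n.+1) ++ map (@omega_ n) (index_enum 'I_n.+1).

Lemma emb_states_uniq : uniq emb_states.
Proof.
rewrite cat_uniq !map_inj_uniq ?index_enum_uniq//=; last 2 first.
- by move=> x y [].
- by move=> x y [].
by rewrite andbT; apply/hasPn => _ /mapP[l _ ->]; apply/mapP => -[].
Qed.

Lemma mem_emb_states x : x \in emb_states.
Proof.
by case: x => l; rewrite mem_cat; apply/orP; [left|right]; apply: map_f;
  rewrite mem_index_enum.
Qed.

Lemma big_emb_states (V : nmodType) (F : emb_state n -> V) :
  (\sum_(y <- emb_states) F y = \sum_l F (s_ l) + \sum_l F (omega_ l))%R.
Proof. by rewrite big_cat !big_map. Qed.

(** The rows of both chains sum to 1 and agree on transitions within Z; subtracting the common part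
    leaves the two exit probabilities. *)
Lemma trans_so_diag j : q (s_ j) (omega_ j) = exitp j.
Proof.
have q0 := mean_trans_ge0 sigma0_stationary.
have p0 := mean_trans_ge0 sM.
have := mean_trans_sum1 sigma0_stationary (Q0M (s_ j)).
rewrite (esum_enum emb_states_uniq mem_emb_states)//.
rewrite big_emb_states/=; under eq_bigr do rewrite trans_ss.
rewrite [X in _ + X](bigD1 j)//= [X in _ + (_ + X)]big1 ?adde0; last first.
  by move=> l; exact: trans_so.
rewrite -(mean_trans_sum1 sM (QM (z j))) [RHS](esumID (range z)); last by move=> y _; exact: p0.
rewrite !setTI esum_range//.
have sf : \sum_l p (z j) (z l) \is a fin_num.
  rewrite ge0_fin_numE ?sume_ge0// -esum_range//.
  apply: (@le_lt_trans _ _ 1); last exact: ltry.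
  rewrite -(mean_trans_sum1 sM (QM (z j))) [leRHS](esumID (range z)); last by move=> y _; exact: p0.
  by rewrite setTI leeDl// esum_ge0.
move/(congr1 (fun u => u - \sum_l p (z j) (z l))).
by rewrite [LHS]addeAC subee// add0e [X in _ = X -> _]addeAC subee// add0e.
Qed.

Local Notation rate := (mean_cost_rate sigma).
Local Notation rate0 := (mean_cost_rate sigma0).
Local Notation cp := (pos_part (cost M)).
Local Notation cn := (neg_part (cost M)).
Local Notation cp0 := (pos_part (cost M0)).
Local Notation cn0 := (neg_part (cost M0)).

Let rate_cp_ge0 x : 0 <= rate cp x.
Proof. by apply: mean_cost_rate_ge0 => y a; exact: pos_part_ge0. Qed.
Let rate_cn_ge0 x : 0 <= rate cn x.
Proof. by apply: mean_cost_rate_ge0 => y a; exact: neg_part_ge0. Qed.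
Let rate0_cp_ge0 x : 0 <= rate0 cp0 x.
Proof. by apply: mean_cost_rate_ge0 => y a; exact: pos_part_ge0. Qed.
Let rate0_cn_ge0 x : 0 <= rate0 cn0 x.
Proof. by apply: mean_cost_rate_ge0 => y a; exact: neg_part_ge0. Qed.

Let m_cp0 x : measurable_fun setT (fun a => (cp0 x a)%:E).
Proof.
by apply/measurable_EFinP; apply: measurable_pos_part; exact: (measurable_cost M0).
Qed.

Let m_cn0 x : measurable_fun setT (fun a => (cn0 x a)%:E).
Proof.
by apply/measurable_EFinP; apply: measurable_neg_part; exact: (measurable_cost M0).
Qed.

Lemma rate_cp_s j : rate0 cp0 (s_ j) = rate cp (z j).
Proof.
rewrite /mean_cost_rate /mean integral_s; [by []|exact: m_cp0|].
by move=> a; rewrite lee_fin pos_part_ge0.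
Qed.

Lemma rate_cn_s j : rate0 cn0 (s_ j) = rate cn (z j).
Proof.
rewrite /mean_cost_rate /mean integral_s; [by []|exact: m_cn0|].
by move=> a; rewrite lee_fin neg_part_ge0.
Qed.

Lemma rate_cp_omega j : vis (z j) -> 0 < exitp j ->
  rate0 cp0 (omega_ j) = (Num.max (oc j) 0%R)%:E.
Proof. by move=> vj ej; rewrite /mean_cost_rate /mean integral_omega//. Qed.

Lemma rate_cn_omega j : vis (z j) -> 0 < exitp j ->
  rate0 cn0 (omega_ j) = (Num.max (- oc j)%R 0%R)%:E.
Proof. by move=> vj ej; rewrite /mean_cost_rate /mean integral_omega//. Qed.

(* Contains every state that the embedded chain reaches from s_i. *)
Definition emb_visited (x : emb_state n) : Prop :=
  match x with
  | inl j => vis (z j)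
  | inr j => vis (z j) /\ 0 < exitp j
  end.

(** The case that is not immediate is omega_j to s_l: a positive entry probability means that an
    excursion of M from z_j ends at z_l, and [excursion_closed] applies. *)
Lemma emb_visited_closed x y : emb_visited x -> 0 < q x y -> emb_visited y.
Proof.
have p0 := mean_trans_ge0 sM.
case: x => j; case: y => l.
- by rewrite (trans_ss j l); exact: visited_closed.
- have [->|lj] := eqVneq l j; first by rewrite (trans_so_diag j).
  by rewrite (trans_so lj) ltxx.
- move=> [vj ej]; rewrite (trans_os l vj ej) lte_fin => pos.
  apply: (excursion_closed p0 (z := z) (visited_closed sM QM (z := z) (i := i)) vj).
  have : (0 < law j l)%R.
    by move: pos; rewrite pmulr_rgt0// (hold_rate_gt0 sM QM z_inj zi_recurrent vj ej).
  rewrite /entry_law; move: (excursion_ge0 sM z j (fun x => p0 x (z l))).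
  rewrite le_eqVlt => /predU1P[<-|//]; by rewrite mul0r ltxx.
- move=> [vj ej]; rewrite (trans_oo l vj ej); have [->//|lj] := eqVneq l j.
  by rewrite ltxx.
Qed.

Local Notation after f l := (fine (green_after p z i f l)).
Local Notation avg := (cycle_average M sigma z i).
Local Notation fexc j f := (fine (exc j f)).

(* Expected relative cost before reaching z_i, from z_l. *)
Let rel l : R :=
  (after (rate cp) l - after (rate cn) l - avg * after (cst 1%E) l)%R.

(** At omega_j this is the relative cost, in M, of an excursion and of what follows it, conditional
    on leaving Z from z_j. In M_0 it is the mean sojourn [1 / lam j] times [oc j - avg], plus the
    mean of [rel] at the entry state. *)
Let potential (x : emb_state n) : R :=
  match x with
  | inl j => rel j
  | inr j => ((fexc j (rate cp) - fexc j (rate cn) - avg * fexc j (cst 1%E) +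
      \sum_l fexc j (p ^~ (z l)) * rel l) / fine (exitp j))%R
  end.

Let sum_rel (w : 'I_n.+1 -> R) : (\sum_l w l * rel l =
  \sum_l w l * after (rate cp) l - \sum_l w l * after (rate cn) l -
  avg * \sum_l w l * after (cst 1%E) l)%R.
Proof.
by rewrite mulr_sumr -!sumrB; apply: eq_bigr => l _; exact: sum_rel_term.
Qed.

Let green_fin_num f x : (forall y, 0 <= f y) -> green p [set z i] f x < +oo ->
  green p [set z i] f x \is a fin_num.
Proof.
by move=> f0; rewrite ge0_fin_numE//; apply: green_ge0 => //; exact: mean_trans_ge0.
Qed.

Local Notation fH f j := (fine (green p [set z i] f (z j))).

Let green1_gt0 : (0 < fH (cst 1%E) i)%R.
Proof.
have p0 := mean_trans_ge0 sM.
have one0 (y : X) : 0 <= (cst 1 y : \bar R) by [].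
have fin := green1_lty sM QM zi_recurrent (visited_zi QM z i).
apply: (@lt_le_trans _ _ 1%R) => //; rewrite -lee_fin fineK; last exact: green_fin_num.
by rewrite green_rec// leeDl//; apply: taboo_ge0 => // y; exact: green_ge0.
Qed.

(** At z_i itself the relative cost of a full cycle is 0 by the choice of [avg], in agreement with
    the value 0 imposed by [green_after]. It is here that the average is determined. *)
Let rel_green j : (fH (rate cp) j - fH (rate cn) j - avg * fH (cst 1%E) j)%R = rel j.
Proof.
rewrite /rel /green_after; case: eqP => [->|//] /=.
rewrite mulr0 !subr0 /cycle_average.
by rewrite divfK ?subrr// gt_eqF.
Qed.

(** When [exitp j] is 0 the division in [potential] is meaningless, but all excursion terms vanish
    as well. *)
Let exit_potential j : vis (z j) ->
  (fine (exitp j) * potential (omega_ j) = fexc j (rate cp) - fexc j (rate cn) -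
    avg * fexc j (cst 1%E) + \sum_l fexc j (p ^~ (z l)) * rel l)%R.
Proof.
move=> vj; rewrite /=; have [e0|e0] := eqVneq (exitp j) 0.
  have x0 f : exc j f = 0.
    by apply: excursion_eq0; [exact: mean_trans_ge0|rewrite -exit_probE].
  rewrite !x0 e0 mul0r big1; first by rewrite /= mulr0 !subr0 addr0.
  by move=> l _; rewrite x0 mul0r.
rewrite mulrC divfK// fine_eq0 ?(exit_prob_fin_num sM QM)//.
Qed.

Lemma potential_poisson x : emb_visited x ->
  (fine (rate0 cp0 x) - fine (rate0 cn0 x) +
   \sum_(y <- emb_states) fine (q x y) * potential y = avg + potential x)%R.
Proof.
have one0 (y : X) : 0 <= (cst 1 y : \bar R) by [].
rewrite big_emb_states; case: x => j.
- move=> vj; rewrite -/(s_ j) rate_cp_s rate_cn_s.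
  under eq_bigr do rewrite trans_ss.
  rewrite [X in (_ + (_ + X))%R](bigD1 j)//=
    [X in (_ + (_ + (_ + X)))%R]big1; last first.
    by move=> l lj; rewrite trans_so// mul0r.
  rewrite addr0 trans_so_diag (exit_potential vj) !sum_rel -rel_green.
  have [_ _ ->] := green_through_fine sM QM z_inj zi_recurrent rate_cp_ge0 vj
    (green_cp_lty sM QM cost_fin vj).
  have [_ _ ->] := green_through_fine sM QM z_inj zi_recurrent rate_cn_ge0 vj
    (green_cn_lty sM QM cost_fin vj).
  have [_ _ ->] := green_through_fine sM QM z_inj zi_recurrent one0 vj
    (green1_lty sM QM zi_recurrent vj).
  exact: poisson_s_identity.
- move=> [vj ej]; rewrite -/(omega_ j) (rate_cp_omega vj ej) (rate_cn_omega vj ej).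
  have e0 : (fine (exitp j) != 0)%R.
    by rewrite fine_eq0 ?(exit_prob_fin_num sM QM)// gt_eqF.
  have l0 := hold_rate_gt0 sM QM z_inj zi_recurrent vj ej.
  have k0 : (fexc j (cst 1%E) != 0)%R.
    by apply: contraTneq l0 => k0; rewrite /hold_rate k0 invr0 mulr0 ltxx.
  rewrite (eq_bigr (fun l => (lam j / fine (exitp j)) *
      (fexc j (p ^~ (z l)) * rel l))%R); last first.
    by move=> l _; rewrite (trans_os l vj ej); exact: omega_term.
  rewrite -mulr_sumr [X in (_ + (_ + X))%R](bigD1 j)//=
    [X in (_ + (_ + (_ + X)))%R]big1; last first.
    by move=> l lj; rewrite (trans_oo l vj ej) (negbTE lj) mul0r.
  rewrite addr0 (trans_oo j vj ej) eqxx /=.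
  (* The action at omega_j is deterministic, so the two mean costs there are the positive and
     negative parts of the single number [oc j]. *)
  have -> : (Num.max (oc j) 0 - Num.max (- oc j) 0 = oc j)%R.
    by case: (leP (oc j) 0%R) => H; case: (leP (- oc j)%R 0%R) => H'; lra.
  exact: poisson_omega_identity.
Qed.

Lemma mean_cost_embedded_cvg :
  mean_cost M0 (Q0 (s_ i)) N @[N --> \oo] --> avg%:E.
Proof.
have q0 := mean_trans_ge0 sigma0_stationary.
have q1 x := mean_trans_sum1 sigma0_stationary (Q0M x).
have one0 (y : X) : 0 <= (cst 1 y : \bar R) by [].
have fpS x : emb_visited x -> rate0 cp0 x < +oo.
  case: x => j; last by move=> [vj ej]; rewrite (rate_cp_omega vj ej) ltry.
  move=> vj; rewrite (rate_cp_s j).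
  by case: (green_through_fine sM QM z_inj zi_recurrent rate_cp_ge0 vj
    (green_cp_lty sM QM cost_fin vj)).
have fnS x : emb_visited x -> rate0 cn0 x < +oo.
  case: x => j; last by move=> [vj ej]; rewrite (rate_cn_omega vj ej) ltry.
  move=> vj; rewrite (rate_cn_s j).
  by case: (green_through_fine sM QM z_inj zi_recurrent rate_cn_ge0 vj
    (green_cn_lty sM QM cost_fin vj)).
have si : emb_visited (s_ i) by exact: (visited_zi QM).
have itp k := iter_step_lty emb_states_uniq mem_emb_states q0 q1 emb_visited_closed
  k rate0_cp_ge0 fpS si.
have itn k := iter_step_lty emb_states_uniq mem_emb_states q0 q1 emb_visited_closed
  k rate0_cn_ge0 fnS si.
have cv := poisson_cesaro emb_states_uniq mem_emb_states q0 q1 emb_visited_closed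
  rate0_cp_ge0 rate0_cn_ge0 fpS fnS potential_poisson si.
have ip0 k : 0 <= iter k (taboo q set0) (rate0 cp0) (s_ i) by exact: iter_taboo_ge0.
have in0 k : 0 <= iter k (taboo q set0) (rate0 cn0) (s_ i) by exact: iter_taboo_ge0.
rewrite (_ : mean_cost M0 (Q0 (s_ i)) = (fun N => (N%:R^-1 *
   \sum_(k < N) (fine (iter k (taboo q set0) (rate0 cp0) (s_ i)) -
    fine (iter k (taboo q set0) (rate0 cn0) (s_ i))))%R%:E)).
  by apply: cvg_EFin; [exact: nearW|exact: cv].
apply/funext => N; rewrite /mean_cost (total_cost_iter sigma0_stationary (Q0M (s_ i)))//.
rewrite EFinM; congr (_ * _); rewrite -sumEFin; apply: eq_bigr => k _.
by rewrite EFinB !fineK// ge0_fin_numE.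
Qed.

End embedded_policy.

Theorem theorem3p1 (R : realType) (X : pcountType) (A : ptopologicalType)
    (M : mdp R X (borel A))
    (act_compact : forall x, compact (act M x : set A))
    (M_nondrifting : nondrifting M)
    (n : nat) (z : 'I_n.+1 -> X) (z_inj : injective z)
    (sigma : X -> probability (borel A) R)
    (sigma_stationary : stationary M sigma)
    (Q : X -> probability (traj X (borel A)) R)
    (Q_law : path_laws M (markov_rule sigma) Q)
    (i : 'I_n.+1) (zi_recurrent : recurrent Q (z i))
    (sigma0 : emb_state n -> probability (borel A + (n.+1.-tuple R * R))%type R)
    (sigma0_associated : associated M z_inj sigma Q sigma0)
    (Q0 : emb_state n ->
      probability (traj (emb_state n) (borel A + (n.+1.-tuple R * R))%type) R)
    (Q0_law : path_laws (embedded_mdp M z_inj) (markov_rule sigma0) Q0)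
    (cost_well_defined :
      (cost_until (fun x a => `|cost M x a|%R) (Q (z i)) (return_time (z i))
       < +oo)%E) :
  exists l : R,
    mean_cost M (Q (z i)) N @[N --> \oo] --> l%:E /\
    mean_cost (embedded_mdp M z_inj) (Q0 (s_ i)) N @[N --> \oo] --> l%:E.
Proof.
exists (cycle_average M sigma z i); split.
  exact: (mean_cost_cvg sigma_stationary Q_law zi_recurrent cost_well_defined).
exact: (mean_cost_embedded_cvg sigma_stationary Q_law zi_recurrent
  cost_well_defined sigma0_associated Q0_law).
Qed.
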